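(* There exists a constant $\varepsilon > 0$ such that the following holds. Let $n \in 3\mathbb{N}$ (a positive multiple of $3$) and let $G$ be a $d$-regular graph on $n$ vertices whose second eigenvalue satisfies $\lambda(G) < \varepsilon d^2/(n \log n)$. Then $G$ contains a triangle-factor.
   Context: Graphs are finite and simple. For a $d$-regular graph $G$ on $n$ vertices with adjacency matrix $A$ having eigenvalues $\lambda_1 \ge \lambda_2 \ge \dots \ge \lambda_n$ (with multiplicity), the second eigenvalue is $\lambda(G) = \max\{|\lambda_2|, |\lambda_n|\}$. A triangle-factor in a graph on $n$ vertices, $n$ divisible by $3$, is a family of $n/3$ pairwise vertex-disjoint triangles (copies of $K_3$ as subgraphs) of the graph. *)

(* Defs.v *)
From HB Require Import structures.
From mathcomp Require Import all_boot all_order all_algebra.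
From mathcomp Require Import reals exp.
From mathcomp Require Import polyrcf.

Set Implicit Arguments.
Unset Strict Implicit.
Unset Printing Implicit Defensive.

Import Order.TTheory GRing.Theory Num.Theory.
Local Open Scope ring_scope.

Record sgraph := SGraph {
  vertex :> finType;
  edge : rel vertex;
  edge_sym : symmetric edge;
  edge_irr : irreflexive edge
}.

Definition regular (G : sgraph) (d : nat) : Prop :=
  forall x : G, #|[set y : G | edge x y]| = d.

Definition adjacency_mx (R : realType) (G : sgraph) : 'M[R]_#|G| :=
  \matrix_(i, j) (edge (enum_val i) (enum_val j))%:R.

(* The real eigenvalues of A in non-increasing order, each repeated according
   to its multiplicity as a root of the characteristic polynomial. *)
Definition eigenvalues (R : realType) (n : nat) (A : 'M[R]_n) : seq R :=
  sort (fun x y => y <= x)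
    (flatten [seq nseq (mup x (char_poly A)) x | x <- rootsR (char_poly A)]).

(* Indices are shifted: lambda_k is the entry of index k - 1. *)
Definition second_eigenvalue (R : realType) (G : sgraph) : R :=
  let s := eigenvalues (adjacency_mx R G) in
  Num.max `|nth 0 s 1| `|nth 0 s #|G|.-1|.

Definition triangle (G : sgraph) (B : {set G}) : Prop :=
  #|B| = 3%N /\ {in B &, forall x y, x != y -> edge x y}.

Definition triangle_factor (G : sgraph) (P : {set {set G}}) : Prop :=
  [/\ #|P| = (#|G| %/ 3)%N, trivIset P & {in P, forall B, triangle B}].

(* Whenever the characteristic polynomial splits over R (as it does for every
   real symmetric matrix), [eigenvalues] is the sorted list of its roots. *)
Lemma eigenvalues_prod (R : realType) (n : nat) (A : 'M[R]_n) (s : seq R) :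
  char_poly A = \prod_(x <- s) ('X - x%:P) ->
  eigenvalues A = sort (fun x y => y <= x) s.
Proof.
move=> eA.
have p0 : char_poly A != 0 by rewrite monic_neq0 ?char_poly_monic.
have leT : total (fun x y : R => y <= x) by move=> x y; exact: le_total.
have leA : antisymmetric (fun x y : R => y <= x).
  by move=> x y /andP[yx xy]; apply/eqP; rewrite eq_le yx xy.
have leTr : transitive (fun x y : R => y <= x).
  by move=> x y z xy zx; exact: le_trans zx xy.
apply/(perm_sortP leT leTr leA)/allP => y _ /=.
rewrite count_flatten -map_comp sumnE big_map.
rewrite (eq_bigr (fun x => if x == y then count_mem y s else 0%N)); last first.
  move=> x _ /=; rewrite count_nseq /= eA mu_prod_XsubC.
  by case: eqP => [->|_]; rewrite ?mul1n.
rewrite -big_mkcond /= big_const_seq iter_addn_0 mulnC.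
rewrite (count_uniq_mem y (uniq_roots _ _ _)) -/(rootsR _).
have [ys|ys] := boolP (y \in rootsR _); first by rewrite mul1n.
rewrite mul0n eq_sym; apply: contraNT ys.
rewrite -lt0n -has_count has_pred1 => ys.
by rewrite -(roots_on_rootsR p0) in_itv /= eA root_prod_XsubC.
Qed.

(* Main.v *)
Require Import Defs.
From mathcomp Require Import all_boot all_order all_algebra.
From mathcomp Require Import reals exp.
From mathcomp Require Import spectral complex zify lra ring.

Import Order.TTheory GRing.Theory Num.Theory.
Local Open Scope ring_scope.

Set Implicit Arguments.
Unset Strict Implicit.
Unset Printing Implicit Defensive.

(** Write [n] for the number of vertices, [p = d / n] for the density and
    [mu = eps * n / ln n]; the hypothesis says that [lambda < p ^ 2 * mu].

    Expansion.  On vectors orthogonal to the constants the adjacency matrix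
    stretches lengths by at most [lambda].  Applied to the centred indicator
    vector of a set [X], this bounds the sum over [v] of
    [(deg v X - p |X|) ^ 2] by [lambda ^ 2 |X|] ([degree_variance]), so only
    few vertices have less than half of the expected number of neighbours in
    [X] ([few_low]).  Choosing vertices that have typical degrees into the
    relevant sets gives an edge between any two sets of order [p * mu], a
    triangle across any two sets of order [mu] and a third one of order only
    [p * mu], and a diamond (two triangles that share an edge) across any
    three sets of order [mu].

    Absorbers.  Call a vertex [v] of [D] spare when [D] without [v] can be
    tiled by triangles.  If a triangle has its corners in the spare sets of
    three disjoint sets, then the union of the three is tiled
    ([tiled_join3]); so sets with many spare vertices are as easy to group in
    threes as large vertex sets are to span triangles.  A diamond glues two
    such sets into one that keeps all spare vertices of both ([spare_join]);
    starting from single vertices and doubling, one finds sets with [2 ^ i]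
    spare vertices among at most [3 * 2 ^ i] vertices ([absorber_exists]).

    Levels.  Let [T] be of order [mu].  About [log n] levels of absorbers are
    set aside; in the level of size [2 ^ i] there are of order [T / 2 ^ i] of
    them, so that a level takes up [O(T)] vertices and all levels together
    only a small part of the graph: this is where the logarithm in the
    hypothesis is spent.  Greedy tiling of everything else leaves fewer than
    [T] single vertices.  They are absorbed by the first level, the remains of
    which are grouped in threes until only [O(T / 2 ^ i)] are left; these are
    absorbed by the second level, and so on ([absorbing_set]).  In the last
    level an absorber has at least [T] spare vertices, so any three of them
    can be grouped, and divisibility by three lets the process end with
    nothing left over. *)

(** * Triangle tilings and spare vertices *)

Section Tilings.
Local Open Scope nat_scope.

Variable G : sgraph.
Implicit Types (x y z : G) (X Y D : {set G}) (F : {set {set G}}).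

Definition is_triangle (B : {set G}) : bool :=
  (#|B| == 3) && [forall x in B, forall y in B, (x != y) ==> edge x y].

Lemma is_triangleP B : reflect (triangle B) (is_triangle B).
Proof.
apply: (iffP andP) => [[/eqP cB /forall_inP eB]|[cB eB]].
  split=> // x y xB yB nxy.
  by have /forall_inP/(_ _ yB)/implyP/(_ nxy) := eB _ xB.
split; first exact/eqP.
by do 2![apply/forall_inP => ? ?]; apply/implyP/eB.
Qed.

Lemma edge_neq x y : edge x y -> x != y.
Proof. by apply: contraTneq => ->; rewrite edge_irr. Qed.

(** Boolean, so that the spare vertices of a set form a finite set. *)
Definition tiled X : bool :=
  [exists F : {set {set G}},
    [&& trivIset F, cover F == X & [forall B in F, is_triangle B]]].

Lemma tiledP X :
  reflect (exists F, [/\ trivIset F, cover F = X & {in F, forall B, triangle B}])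
          (tiled X).
Proof.
apply: (iffP existsP) => -[F].
  case/and3P=> tF /eqP cF /forall_inP aF; exists F; split=> // B BF.
  exact/is_triangleP/aF.
case=> tF cF aF; exists F; rewrite tF cF eqxx /=.
by apply/forall_inP => B /aF /is_triangleP.
Qed.

Lemma tiled0 : tiled set0.
Proof.
apply/tiledP; exists set0; split=> [||B]; last by rewrite inE.
  by apply/trivIsetP => A B; rewrite inE.
by rewrite /cover big_set0.
Qed.

Lemma tiledU X Y : [disjoint X & Y] -> tiled X -> tiled Y -> tiled (X :|: Y).
Proof.
move=> dXY /tiledP[F [tF cF aF]] /tiledP[H [tH cH aH]].
apply/tiledP; exists (F :|: H); split.
- by apply: trivIsetU; rewrite ?cF ?cH.
- by rewrite /cover bigcup_setU -!/(cover _) cF cH.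
- by move=> B; rewrite inE => /orP[/aF|/aH].
Qed.

Lemma tiled3 x y z :
  edge x y -> edge x z -> edge y z -> tiled [set x; y; z].
Proof.
move=> exy exz eyz; apply/tiledP; exists [set [set x; y; z]].
split; [exact: trivIset1|exact: cover1|move=> B; rewrite inE => /eqP->].
split=> [|u v].
  rewrite setUC cardsU1 cards2 !inE edge_neq // negb_or.
  by rewrite !(eq_sym z) !edge_neq.
by rewrite !inE -!orbA => /or3P[] /eqP-> /or3P[] /eqP->;
  rewrite ?eqxx // edge_sym.
Qed.

Lemma tiled_dvd X : tiled X -> 3 %| #|X|.
Proof.
case/tiledP=> F [/eqP tF <- aF]; rewrite -tF; apply: dvdn_sum => B BF.
by have [-> _] := aF B BF.
Qed.

Lemma tiled_factor : tiled [set: G] -> exists F, triangle_factor F.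
Proof.
case/tiledP=> F [tF cF aF]; exists F; split=> //.
rewrite -cardsT -cF -(eqP tF) (eq_bigr (fun=> 3)) => [|B /aF[]//].
by rewrite sum_nat_const mulnK.
Qed.

(** A spare vertex may be used in a triangle elsewhere, at no cost: the rest
    of its set can be tiled. *)
Definition spare D : {set G} := [set v in D | tiled (D :\ v)].

Lemma spare_sub D : spare D \subset D.
Proof. by apply/subsetP => x; rewrite inE => /andP[]. Qed.

Lemma spare1 x : spare [set x] = [set x].
Proof.
apply/setP=> y; rewrite !inE; case: eqVneq => //= ->.
by rewrite setDv tiled0.
Qed.

Lemma spare_mod3 D x : x \in spare D -> #|D| = 1 %[mod 3].
Proof.
rewrite inE => /andP[xD /tiled_dvd /dvdnP[q Eq]].
by rewrite (cardsD1 x) xD Eq -modnDmr modnMl.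
Qed.

(** When [v] is taken out of [D1], the rest of [D1] is tiled, [t a b] is a
    triangle and the rest of [D2] is tiled because [t] is spare there. *)
Lemma spare_joinl (D1 D2 : {set G}) s t a b :
    [disjoint D1 & D2] -> a \notin D1 :|: D2 -> b \notin D1 :|: D2 ->
    t \in spare D2 -> edge s a -> edge a b -> edge t a -> edge t b ->
  spare D1 \subset spare (D1 :|: D2 :|: [set a; b]).
Proof.
move=> dD aD bD; rewrite inE => /andP[tD2 tT] esa eab eta etb.
apply/subsetP=> v; rewrite inE => /andP[vD1 vT].
rewrite !inE vD1 /=; move: aD bD; rewrite !inE !negb_or.
move=> /andP[aD1 aD2] /andP[bD1 bD2].
have vD2 : v \notin D2 by rewrite (disjointFr dD vD1).
have tD1 : t \notin D1 by rewrite (disjointFl dD tD2).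
suff -> : (D1 :|: D2 :|: [set a; b]) :\ v =
    (D1 :\ v) :|: (D2 :\ t) :|: [set t; a; b].
  apply: tiledU; last exact: tiled3.
    rewrite disjoint_sym disjoints_subset; apply/subsetP=> u.
    rewrite !inE negb_or !negb_and !negbK -orbA.
    by case/or3P => /eqP->; rewrite ?eqxx ?tD1 ?aD1 ?aD2 ?bD1 ?bD2 ?orbT.
  apply: tiledU => //.
  by apply: disjointWl (subD1set _ _) _; apply: disjointWr (subD1set _ _) _.
apply/setP=> u; rewrite !inE.
case: (eqVneq u v) => [->|_] /=.
  rewrite (negPf vD2) andbF /=; apply/esym/negbTE.
  by rewrite !negb_or (memPn tD1) // (memPn aD1) // (memPn bD1).
by case: (eqVneq u t) => [->|_]; rewrite ?tD2 ?orbT //= !orbF ?orbA.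
Qed.

(** By symmetry the triangle [s a b] is used when the missing vertex lies in
    [D2]: the pair [a], [b] works as a switch between the two sets. *)
Lemma spare_join (D1 D2 : {set G}) s t a b :
    [disjoint D1 & D2] -> a \notin D1 :|: D2 -> b \notin D1 :|: D2 ->
    s \in spare D1 -> t \in spare D2 ->
    edge s a -> edge s b -> edge a b -> edge t a -> edge t b ->
  spare D1 :|: spare D2 \subset spare (D1 :|: D2 :|: [set a; b]).
Proof.
move=> dD aD bD sD tD esa esb eab eta etb; rewrite subUset.
rewrite (spare_joinl dD aD bD tD esa eab eta etb) /= [D1 :|: D2]setUC.
by apply: (spare_joinl _ _ _ sD eta eab esa esb);
  rewrite ?[D2 :|: D1]setUC // disjoint_sym.
Qed.

(** The three corners are spare, so the triangle and the tilings of the three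
    remainders together tile the union. *)
Lemma tiled_join3 (D1 D2 D3 : {set G}) x y z :
    [disjoint D1 & D2] -> [disjoint D1 & D3] -> [disjoint D2 & D3] ->
    x \in spare D1 -> y \in spare D2 -> z \in spare D3 ->
    edge x y -> edge x z -> edge y z ->
  tiled (D1 :|: D2 :|: D3).
Proof.
move=> d12 d13 d23; rewrite !inE.
move=> /andP[xD xT] /andP[yD yT] /andP[zD zT] exy exz eyz.
suff -> : D1 :|: D2 :|: D3 =
    (D1 :\ x) :|: (D2 :\ y) :|: (D3 :\ z) :|: [set x; y; z].
  apply: tiledU; last exact: tiled3.
    rewrite disjoint_sym disjoints_subset; apply/subsetP=> u.
    rewrite !inE !negb_or !negb_and !negbK -orbA; case/or3P => /eqP->;
    rewrite ?eqxx ?(disjointFr d12 xD) ?(disjointFr d13 xD) ?(disjointFr d23 yD);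
    by rewrite ?(disjointFl d12 yD) ?(disjointFl d13 zD) ?(disjointFl d23 zD) ?orbT.
  have sD (A : {set G}) u : A :\ u \subset A by exact: subD1set.
  apply: tiledU => //; last first.
    by apply: tiledU => //; apply: disjointWl (sD _ _) _; apply: disjointWr d12.
  rewrite disjoints_subset subUset -!disjoints_subset; apply/andP; split.
    by apply: disjointWl (sD _ _) _; apply: disjointWr d13.
  by apply: disjointWl (sD _ _) _; apply: disjointWr d23.
apply/setP=> u; rewrite !inE.
case: (eqVneq u x) => [->|_]; first by rewrite xD !orbT.
case: (eqVneq u y) => [->|_]; first by rewrite yD !orbT.
case: (eqVneq u z) => [->|_]; first by rewrite zD !orbT.
by rewrite !orbF.
Qed.

End Tilings.

(** * Tiling families of disjoint sets *)

Lemma subset_of_card (T : finType) (A : {set T}) (n : nat) :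
  (n <= #|A|)%N -> exists2 B : {set T}, B \subset A & #|B| = n.
Proof.
case/card_geqP => s [us <- sA]; exists [set x in s].
  by apply/subsetP => x; rewrite inE => /sA.
by rewrite cardsE; apply/card_uniqP.
Qed.

Lemma card_disjointU (T : finType) (A B : {set T}) :
  [disjoint A & B] -> #|A :|: B| = (#|A| + #|B|)%N.
Proof. by move=> dAB; apply/eqP; rewrite (leq_card_setU A B).2. Qed.

Lemma halve (T : finType) (A : {set T}) (n : nat) : #|A| = (2 * n)%N ->
  exists X Y : {set T}, [/\ X :|: Y = A, [disjoint X & Y], #|X| = n & #|Y| = n].
Proof.
move=> cA; have [|X sX cX] := @subset_of_card _ A n; first by rewrite cA leq_pmull.
exists X, (A :\: X); split=> //.
- by rewrite -{1}(setIidPr sX) setID.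
- by rewrite disjoint_sym disjoints_subset subsetDr.
- by rewrite cardsD (setIidPr sX) cX cA mul2n -addnn addnK.
Qed.

Section Families.
Local Open Scope nat_scope.

Variable G : sgraph.
Implicit Types (x y z : G) (X Y D : {set G}) (F K : {set {set G}}).

Definition spares F : {set G} := \bigcup_(D in F) spare D.

Lemma sparesP F x :
  reflect (exists2 D, D \in F & x \in spare D) (x \in spares F).
Proof. exact: bigcupP. Qed.

Lemma spares_subset F K : F \subset K -> spares F \subset spares K.
Proof.
move=> sFK; apply/subsetP=> x /sparesP[D DF xD]; apply/sparesP.
by exists D => //; apply: subsetP DF.
Qed.

Lemma trivIset_disjoint F D1 D2 : trivIset F -> D1 \in F -> D2 \in F ->
  D1 != D2 -> [disjoint D1 & D2].
Proof. by move/trivIsetP; apply. Qed.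

Lemma card_cover_le F q :
  {in F, forall D, #|D| <= q} -> #|cover F| <= #|F| * q.
Proof.
move=> qF; apply: leq_trans (leq_card_cover F) _.
by rewrite -sum_nat_const; apply: leq_sum.
Qed.

Lemma card_spares_ge F l : trivIset F ->
  {in F, forall D, l <= #|spare D|} -> #|F| * l <= #|spares F|.
Proof.
move=> tF lF; have [->|l0] := posnP l; first by rewrite muln0.
(* Nonempty spare sets of disjoint sets are distinct. *)
have spI : {in F &, injective (@spare G)}.
  move=> D1 D2 D1F D2F eD; apply: contraTeq (lF _ D1F) => nD.
  rewrite -ltnNge -[spare D1]setIid {2}eD.
  suff /eqP-> : spare D1 :&: spare D2 == set0 by rewrite cards0.
  rewrite setI_eq0; apply: disjointWl (spare_sub _) _.
  by apply: disjointWr (spare_sub _) _; exact: trivIset_disjoint tF D1F D2F nD.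
have tS : trivIset (@spare G @: F).
  apply/trivIsetP => _ _ /imsetP[D1 D1F ->] /imsetP[D2 D2F ->] nS.
  apply: disjointWl (spare_sub _) _; apply: disjointWr (spare_sub _) _.
  by apply: (trivIset_disjoint tF D1F D2F); apply: contraNneq nS => ->.
have -> : spares F = cover (@spare G @: F) by rewrite cover_imset.
rewrite -(eqP tS) big_imset //= -sum_nat_const.
exact: leq_sum.
Qed.

Lemma disjoint_cover F K1 K2 : trivIset F -> K1 \subset F -> K2 \subset F ->
  [disjoint K1 & K2] -> [disjoint cover K1 & cover K2].
Proof.
move=> tF s1 s2 dK; rewrite disjoints_subset; apply/subsetP=> x.
case/bigcupP=> D1 DK1 xD1; rewrite inE; apply/bigcupP => -[D2 DK2 xD2].
have nD : D1 != D2.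
  by apply: contraTneq DK1 => ->; rewrite (disjointFl dK DK2).
have := trivIset_disjoint tF (subsetP s1 _ DK1) (subsetP s2 _ DK2) nD.
by move/disjointFr => /(_ _ xD1); rewrite xD2.
Qed.

Lemma coverU F K : cover (F :|: K) = cover F :|: cover K.
Proof. exact: bigcup_setU. Qed.

Lemma cover_subset F K : F \subset K -> cover F \subset cover K.
Proof. by move=> sFK; rewrite -(setUidPr sFK) coverU subsetUl. Qed.

Lemma tiled_coverU F K1 K2 : trivIset F -> K1 \subset F -> K2 \subset F ->
  [disjoint K1 & K2] -> tiled (cover K1) -> tiled (cover K2) ->
  tiled (cover (K1 :|: K2)).
Proof.
by move=> tF s1 s2 dK t1 t2; rewrite coverU; apply: tiledU => //;
  exact: (disjoint_cover tF s1 s2 dK).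
Qed.

Lemma tiled_cover0 : tiled (cover (set0 : {set {set G}})).
Proof. by rewrite /cover big_set0 tiled0. Qed.

(** [tiled_join3] for families: the corners only need to be spare in some
    member of each. *)
Lemma tiled_cover3 F K1 K2 K3 x y z : trivIset F ->
    K1 \subset F -> K2 \subset F -> K3 \subset F ->
    [disjoint K1 & K2] -> [disjoint K1 & K3] -> [disjoint K2 & K3] ->
    x \in spares K1 -> y \in spares K2 -> z \in spares K3 ->
    edge x y -> edge x z -> edge y z ->
  exists D1 D2 D3, [/\ D1 \in K1, D2 \in K2, D3 \in K3
    & tiled (cover [set D1; D2; D3])].
Proof.
move=> tF s1 s2 s3 d12 d13 d23 /sparesP[D1 D1K xD] /sparesP[D2 D2K yD].
case/sparesP=> [D3 D3K zD] exy exz eyz; exists D1, D2, D3; split=> //.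
rewrite !coverU !cover1.
have dd (A B : {set {set G}}) C E : A \subset F -> B \subset F ->
    [disjoint A & B] -> C \in A -> E \in B -> [disjoint C & E].
  move=> sA sB dAB CA EB; apply: (trivIset_disjoint tF).
  - exact: subsetP CA.
  - exact: subsetP EB.
  - by apply: contraTneq CA => ->; rewrite (disjointFl dAB EB).
apply: tiled_join3 xD yD zD exy exz eyz.
- exact: dd d12 _ _.
- exact: dd d13 _ _.
- exact: dd d23 _ _.
Qed.

Definition deg x X := #|[set y in X | edge x y]|.

Lemma deg_subset x X Y : X \subset Y -> deg x X <= deg x Y.
Proof. move=> sXY; apply/subset_leq_card/subsetP=> y; rewrite !inE.
by case/andP => /(subsetP sXY)->. Qed.

Lemma deg_leD x X Y : deg x X <= deg x (X :\: Y) + #|Y|.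
Proof.
have [le _] := leq_card_setU [set y in X :\: Y | edge x y] Y.
apply: leq_trans le.
apply/subset_leq_card/subsetP=> y; rewrite !inE => /andP[-> ->].
by case: (y \in Y).
Qed.

Variables T m : nat.
Hypothesis m_gt0 : 0 < m.
Hypothesis m_le_T : m <= T.
(** The pseudorandomness that the combinatorial part relies on.  The scale [m]
    may be much smaller than [T]; that a third set of size [m] is enough for a
    triangle is what keeps the part left over by [tile_mass] small. *)
Hypothesis edge_between : forall X Y, m <= #|X| -> m <= #|Y| ->
  exists x y, [/\ x \in X, y \in Y & edge x y].
Hypothesis triangle_across : forall X Y Z : {set G},
  T <= #|X| -> T <= #|Y| -> m <= #|Z| ->
  exists x y z, [/\ x \in X, y \in Y & z \in Z] /\
    [/\ edge x y, edge x z & edge y z].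

(** As long as the members of [Z] have [m] spare vertices in total, there is a
    triangle across them, the spare vertices of [X] and those of [Y].  Every
    step uses one member of each family, so [X] and [Y] stay above the
    threshold [T] until [Z] is nearly exhausted. *)
Lemma tile_mass l (Z X Y : {set {set G}}) :
    trivIset (Z :|: X :|: Y) ->
    [disjoint X & Y] -> [disjoint X & Z] -> [disjoint Y & Z] ->
    {in X :|: Y, forall D, l <= #|spare D|} ->
    T + #|Z| * l <= #|X| * l -> T + #|Z| * l <= #|Y| * l ->
  exists K, [/\ K \subset Z :|: X :|: Y, tiled (cover K)
    & #|spares (Z :\: K)| < m].
Proof.
have [n] := ubnP #|Z|; elim: n Z X Y => // n IHn Z X Y Zn.
set F := Z :|: X :|: Y => tF dXY dXZ dYZ lD TX TY.
have [Zm|Zm] := ltnP #|spares Z| m.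
  by exists set0; rewrite sub0set tiled_cover0 setD0.
have sX : X \subset F by rewrite /F setUAC subsetUr.
have sY : Y \subset F by rewrite subsetUr.
have sZ : Z \subset F by rewrite /F -setUA subsetUl.
have lX : T <= #|spares X|.
  apply: leq_trans (leq_trans (leq_addr _ _) TX) (card_spares_ge _ _).
    exact: trivIsetS tF.
  by move=> D DX; apply: lD; rewrite inE DX.
have lY : T <= #|spares Y|.
  apply: leq_trans (leq_trans (leq_addr _ _) TY) (card_spares_ge _ _).
    exact: trivIsetS tF.
  by move=> D DX; apply: lD; rewrite inE DX orbT.
have [x [y [z [[xX yY zZ] [exy exz eyz]]]]] := triangle_across lX lY Zm.
have [D1 [D2 [D3 [D1X D2Y D3Z tD]]]] :=
  tiled_cover3 tF sX sY sZ dXY dXZ dYZ xX yY zZ exy exz eyz.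
have cX := cardsD1 D1 X; rewrite D1X add1n in cX.
have cY := cardsD1 D2 Y; rewrite D2Y add1n in cY.
have cZ := cardsD1 D3 Z; rewrite D3Z add1n in cZ.
have sF' : (Z :\ D3) :|: (X :\ D1) :|: (Y :\ D2) \subset F.
  by rewrite /F !setUSS // subD1set.
have {IHn}[|||||||| K [sK tK mK]] := IHn (Z :\ D3) (X :\ D1) (Y :\ D2).
- by rewrite -ltnS -cZ.
- exact: trivIsetS tF.
- by apply: disjointWl (subD1set _ _) _; apply: disjointWr dXY; apply: subD1set.
- by apply: disjointWl (subD1set _ _) _; apply: disjointWr dXZ; apply: subD1set.
- by apply: disjointWl (subD1set _ _) _; apply: disjointWr dYZ; apply: subD1set.
- by move=> D DXY; apply: lD; apply: subsetP DXY; rewrite setUSS // subD1set.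
- by move: TX; rewrite cX cZ !mulSn addnCA leq_add2l.
- by move: TY; rewrite cY cZ !mulSn addnCA leq_add2l.
have sD : [set D1; D2; D3] \subset F.
  by rewrite !subUset !sub1set (subsetP sX _ D1X) (subsetP sY _ D2Y) (subsetP sZ _ D3Z).
exists (K :|: [set D1; D2; D3]); split.
- by rewrite subUset sD (subset_trans sK sF').
- apply: (tiled_coverU tF _ sD _ tK tD); first exact: subset_trans sF'.
  apply: disjointWl sK _; rewrite disjoint_sym disjoints_subset.
  rewrite !subUset !sub1set !inE !eqxx D1X D2Y D3Z.
  rewrite (disjointFr dXY D1X) (disjointFr dXZ D1X) (disjointFr dYZ D2Y).
  rewrite (disjointFl dXY D2Y) (disjointFl dXZ D3Z) (disjointFl dYZ D3Z).
  by rewrite !andbF.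
- apply: leq_ltn_trans mK; apply/subset_leq_card/spares_subset.
  by apply/subsetP=> D; rewrite !inE !negb_or => /andP[/andP[-> /andP[_ ->]] ->].
Qed.

(** The few members of [Z] that [tile_mass] leaves may have too few spare
    vertices for a density argument, and each is treated on its own: it has a
    spare vertex [v] with many neighbours in both reserves [X] and [Y], hence
    with an edge between these neighbourhoods.  A step destroys at most [q] of
    the neighbours in either reserve, which [h] must be able to pay for. *)
Lemma tile_reserve q h (Z X Y : {set {set G}}) :
    trivIset (Z :|: X :|: Y) ->
    [disjoint X & Y] -> [disjoint X & Z] -> [disjoint Y & Z] ->
    {in X :|: Y, forall D, #|D| <= q} ->
    {in Z, forall D, exists2 v, v \in spare D
       & h <= deg v (spares X) /\ h <= deg v (spares Y)} ->
    #|Z| * q + m <= h ->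
  exists K, [/\ K \subset Z :|: X :|: Y, tiled (cover K) & Z \subset K].
Proof.
have [n] := ubnP #|Z|; elim: n h Z X Y => // n IHn h Z X Y Zn.
set F := Z :|: X :|: Y => tF dXY dXZ dYZ qD hZ Zh.
have [->|[D3 D3Z]] := set_0Vmem Z.
  by exists set0; rewrite !sub0set tiled_cover0.
have sX : X \subset F by rewrite /F setUAC subsetUr.
have sY : Y \subset F by rewrite subsetUr.
have sZ : Z \subset F by rewrite /F -setUA subsetUl.
have [v vD3 [hX hY]] := hZ _ D3Z.
have mh : m <= h := leq_trans (leq_addl _ _) Zh.
have [x [y []]] := edge_between (leq_trans mh hX) (leq_trans mh hY).
rewrite !inE => /andP[xX evx] /andP[yY evy] exy.
have vZ : v \in spares Z by apply/sparesP; exists D3.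
have [D1 [D2 [D3' [D1X D2Y D3Z' tD]]]] :
    exists D1 D2 D3', [/\ D1 \in X, D2 \in Y, D3' \in [set D3]
      & tiled (cover [set D1; D2; D3'])].
  apply: (tiled_cover3 (x := x) (y := y) (z := v) tF) => //.
  - by rewrite sub1set (subsetP sZ).
  - by apply: disjointWr dXZ; rewrite sub1set.
  - by apply: disjointWr dYZ; rewrite sub1set.
  - by apply/sparesP; exists D3; rewrite ?set11.
  - by rewrite edge_sym.
  - by rewrite edge_sym.
move: D3Z'; rewrite inE => /eqP eD3; subst D3'.
have cZ := cardsD1 D3 Z; rewrite D3Z add1n in cZ.
have sF' : (Z :\ D3) :|: (X :\ D1) :|: (Y :\ D2) \subset F.
  by rewrite /F !setUSS // subD1set.
have hD (A : {set {set G}}) E u : E \in A -> E \in X :|: Y ->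
    h <= deg u (spares A) -> h - q <= deg u (spares (A :\ E)).
  move=> EA EXY hu; rewrite leq_subLR addnC.
  apply: leq_trans hu (leq_trans (deg_leD u _ E) _); apply: leq_add (qD _ EXY).
  apply: deg_subset; apply/subsetP=> w; rewrite inE => /andP[wE].
  case/sparesP=> E' E'A wE'; apply/sparesP; exists E' => //.
  rewrite !inE E'A andbT; apply: contraNneq wE => <-.
  exact: subsetP (spare_sub _) _ wE'.
have {IHn}[|||||||| K [sK tK mK]] := IHn (h - q) (Z :\ D3) (X :\ D1) (Y :\ D2).
- by rewrite -ltnS -cZ.
- exact: trivIsetS tF.
- by apply: disjointWl (subD1set _ _) _; apply: disjointWr dXY; apply: subD1set.
- by apply: disjointWl (subD1set _ _) _; apply: disjointWr dXZ; apply: subD1set.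
- by apply: disjointWl (subD1set _ _) _; apply: disjointWr dYZ; apply: subD1set.
- by move=> D DXY; apply: qD; apply: subsetP DXY; rewrite setUSS // subD1set.
- move=> D; rewrite inE => /andP[_ /hZ[u uD [uX uY]]]; exists u => //.
  by split; apply: hD; rewrite ?inE ?D1X ?D2Y ?orbT.
- move: Zh; rewrite cZ mulSn -addnA => Zh.
  by rewrite leq_subRL // (leq_trans _ Zh) ?leq_addr.
have sD : [set D1; D2; D3] \subset F.
  by rewrite !subUset !sub1set (subsetP sX _ D1X) (subsetP sY _ D2Y) (subsetP sZ _ D3Z).
exists (K :|: [set D1; D2; D3]); split.
- by rewrite subUset sD (subset_trans sK sF').
- apply: (tiled_coverU tF _ sD _ tK tD); first exact: subset_trans sF'.
  apply: disjointWl sK _; rewrite disjoint_sym disjoints_subset.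
  rewrite !subUset !sub1set !inE !eqxx D1X D2Y D3Z.
  rewrite (disjointFr dXY D1X) (disjointFr dXZ D1X) (disjointFr dYZ D2Y).
  rewrite (disjointFl dXY D2Y) (disjointFl dXZ D3Z) (disjointFl dYZ D3Z).
  by rewrite !andbF.
- apply/subsetP=> D DZ; rewrite !inE; case: (eqVneq D D3) => [_|nD].
    by rewrite !orbT.
  by rewrite (subsetP mK) // !inE nD.
Qed.

(** While there are [3 * N] members, they can be split into three groups each
    with at least [T] spare vertices. *)
Lemma tile_triples l N F : trivIset F -> {in F, forall D, l <= #|spare D|} ->
    T <= N * l ->
  exists K, [/\ K \subset F, tiled (cover K) & #|F :\: K| < 3 * N].
Proof.
have [n] := ubnP #|F|; elim: n F => // n IHn F Fn tF lF TN.
have [Fs|Fs] := ltnP #|F| (3 * N).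
  by exists set0; rewrite sub0set tiled_cover0 setD0.
have [|X sX cX] := @subset_of_card _ F N; first by apply: leq_trans Fs; rewrite leq_pmull.
have [|Y sY cY] := @subset_of_card _ (F :\: X) N.
  by rewrite cardsD (setIidPr sX) cX leq_subRL; [rewrite addnn -mul2n|];
    apply: leq_trans Fs; rewrite ?leq_pmull // leq_mul2r orbT.
have [|Z sZ cZ] := @subset_of_card _ (F :\: (X :|: Y)) N.
  rewrite cardsD leq_subRL; last exact: subset_leq_card (subsetIl _ _).
  apply: leq_trans Fs; rewrite mulSn addnC leq_add2l.
  apply: leq_trans (subset_leq_card (subsetIr _ _)) _.
  by apply: leq_trans (leq_card_setU X Y).1 _; rewrite cX cY addnn mul2n.
have sYF : Y \subset F := subset_trans sY (subsetDl _ _).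
have sZF : Z \subset F := subset_trans sZ (subsetDl _ _).
have dXY : [disjoint X & Y].
  by rewrite disjoint_sym; apply: disjointWl sY _; rewrite disjoints_subset subsetDr.
have dXYZ : [disjoint X :|: Y & Z].
  by rewrite disjoint_sym; apply: disjointWl sZ _; rewrite disjoints_subset subsetDr.
have dXZ : [disjoint X & Z] by apply: disjointWl (subsetUl _ _) dXYZ.
have dYZ : [disjoint Y & Z] by apply: disjointWl (subsetUr _ _) dXYZ.
have big (A : {set {set G}}) : A \subset F -> #|A| = N -> T <= #|spares A|.
  move=> sA cA; apply: leq_trans TN _; rewrite -cA; apply: card_spares_ge.
    exact: trivIsetS tF.
  by move=> D /(subsetP sA)/lF.
have [x [y [z [[xX yY zZ] [exy exz eyz]]]]] :=
  triangle_across (big _ sX cX) (big _ sYF cY) (leq_trans m_le_T (big _ sZF cZ)).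
have [D1 [D2 [D3 [D1X D2Y D3Z tD]]]] :=
  tiled_cover3 tF sX sYF sZF dXY dXZ dYZ xX yY zZ exy exz eyz.
have sD : [set D1; D2; D3] \subset F.
  by rewrite !subUset !sub1set (subsetP sX _ D1X) (subsetP sYF _ D2Y) (subsetP sZF _ D3Z).
have [|||| K [sK tK mK]] := IHn (F :\: [set D1; D2; D3]) => //.
- rewrite -ltnS; apply: leq_trans Fn; rewrite ltnS; apply: proper_card.
  rewrite properE subsetDl; apply/subsetPn; exists D1; first exact: subsetP D1X.
  by rewrite !inE eqxx.
- exact: trivIsetD.
- by move=> D; rewrite inE => /andP[_ /lF].
exists (K :|: [set D1; D2; D3]); split.
- by rewrite subUset sD (subset_trans sK (subsetDl _ _)).
- apply: (tiled_coverU tF _ sD _ tK tD); first exact: subset_trans sK (subsetDl _ _).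
  by apply: disjointWl sK _; rewrite disjoints_subset subsetDr.
- by rewrite setUC -setDDl.
Qed.

(** ** Building absorbers by doubling *)

(** A diamond with its two ends in [S] and [W] and its central edge in [U]. *)
Hypothesis diamond_across : forall S W U : {set G},
  T <= #|S| -> T <= #|W| -> T <= #|U| ->
  exists s t a b, [/\ s \in S, t \in W, a \in U & b \in U] /\
    [/\ edge s a, edge s b, edge a b, edge t a & edge t b].

(** The term [2] makes the size bound stable under doubling: two absorbers and
    a pair of new vertices have at most [2 * (3 * 2 ^ i - 2) + 2] vertices. *)
Definition absorber i D := (2 ^ i <= #|spare D|) && (#|D| + 2 <= 3 * 2 ^ i).

Lemma absorber_spare i D : absorber i D -> 2 ^ i <= #|spare D|.
Proof. by case/andP. Qed.

Lemma absorber_card i D : absorber i D -> #|D| <= 3 * 2 ^ i.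
Proof. by case/andP=> _; apply: leq_trans (leq_addr _ _). Qed.

Lemma absorber_family i A :
    (forall U : {set G}, A <= #|U| -> exists2 D : {set G}, D \subset U & absorber i D) ->
  forall c (U : {set G}), c * (3 * 2 ^ i) + A <= #|U| ->
  exists F, [/\ #|F| = c, trivIset F, cover F \subset U
    & {in F, forall D, absorber i D}].
Proof.
move=> exA; elim=> [|c IHc] U cU.
  exists set0; rewrite cards0 /cover big_set0 sub0set.
  by split=> // [|D]; [apply/trivIsetP=> A' B|]; rewrite inE.
have [|F [cF tF sF aF]] := IHc U.
  by apply: leq_trans cU; rewrite leq_add2r leq_mul2r leqnSn orbT.
have [|D sD aD] := exA (U :\: cover F).
  rewrite cardsD (setIidPr sF) leq_subRL ?subset_leq_card //.
  apply: leq_trans cU; rewrite leq_add2r; apply: leq_trans (leq_mul (leqnSn c) (leqnn _)).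
  by rewrite -cF; apply: card_cover_le => E /aF/absorber_card.
have dD : [disjoint D & cover F].
  by apply: disjointWl sD _; rewrite disjoints_subset subsetDr.
have DF : D \notin F.
  apply: contraL (absorber_spare aD) => DF; rewrite -ltnNge.
  suff /eqP-> : spare D == set0 by rewrite cards0 expn_gt0.
  rewrite -subset0; apply/subsetP=> x xD; have {}xD := subsetP (spare_sub D) _ xD.
  have xF : x \in cover F by apply/bigcupP; exists D.
  by move: (disjointFr dD xD); rewrite xF.
exists (D |: F); split.
- by rewrite cardsU1 DF cF.
- by apply: trivIsetU => //; rewrite ?trivIset1 // cover1.
- by rewrite coverU cover1 subUset sF (subset_trans sD (subsetDl _ _)).
- by move=> E; rewrite !inE => /orP[/eqP->|/aF].
Qed.

Lemma ceil_mul_ge i : T <= (T %/ 2 ^ i).+1 * 2 ^ i.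
Proof. by rewrite ltnW // ltn_ceil ?expn_gt0. Qed.

Lemma ceil_mul_le i : 2 ^ i <= T -> (T %/ 2 ^ i).+1 * 2 ^ i <= 2 * T.
Proof. by move=> iT; rewrite mulSn mul2n -addnn leq_add // leq_divM. Qed.

(** Two families of absorbers of size [2 ^ i] with at least [T] spare vertices
    each are taken out of [U], at most [6 * T] vertices per family.  A diamond
    between them, with its central edge in what remains of [U], glues two of
    their members.  So one doubling costs [12 * T] vertices and a pool of
    size [T]. *)
Lemma absorber_exists i (U : {set G}) :
  2 ^ i <= 2 * T -> (13 * i + 1) * T <= #|U| ->
  exists2 D : {set G}, D \subset U & absorber i D.
Proof.
elim: i U => [|i IHi] U iT cU.
  have /card_gt0P[x xU] : 0 < #|U|.
    by apply: leq_trans cU; rewrite mul1n (leq_trans m_gt0).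
  by exists [set x]; rewrite ?sub1set // /absorber spare1 cards1.
have {}iT : 2 ^ i <= T by rewrite expnS leq_pmul2l in iT.
have iT2 : 2 ^ i <= 2 * T by apply: leq_trans iT _; rewrite leq_pmull.
have exi := absorber_family (fun U => IHi U iT2).
set N := (T %/ 2 ^ i).+1.
have N3 : N * (3 * 2 ^ i) <= 6 * T.
  by rewrite mulnCA -[6]/(3 * 2) -mulnA leq_mul2l ceil_mul_le.
have leD (A B : {set G}) a b : b + a <= #|A| -> #|B| <= b -> a <= #|A :\: B|.
  move=> cA cB; rewrite cardsD leq_subRL; last exact: subset_leq_card (subsetIl _ _).
  apply: leq_trans cA; rewrite leq_add2r; apply: leq_trans cB.
  exact: subset_leq_card (subsetIr _ _).
have ar : 6 * T + (N * (3 * 2 ^ i) + (13 * i + 1) * T) <= #|U| /\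
   (6 * T + (6 * T + T)) <= #|U|.
  have e : (13 * i.+1 + 1) * T = (13 * i + 1) * T + 13 * T.
    by rewrite -mulnDl addnAC mulnS [13 + _]addnC.
  by move: cU N3; rewrite e; move: #|U| (N * _) ((13 * i + 1) * T); clear; lia.
have [|F1 [c1 t1 s1 a1]] := exi N U.
  by apply: leq_trans ar.1; rewrite leq_addl.
have cov F : #|F| = N -> {in F, forall D, absorber i D} -> #|cover F| <= 6 * T.
  move=> cF aF; apply: leq_trans N3; rewrite -cF.
  by apply: card_cover_le => D /aF/absorber_card.
have [|F2 [c2 t2 s2 a2]] := exi N (U :\: cover F1).
  by apply: (leD _ _ _ _ _ (cov _ c1 a1)); exact: ar.1.
have cW : T <= #|U :\: cover F1 :\: cover F2|.
  by apply: (leD _ _ _ _ _ (cov _ c2 a2));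
    apply: (leD _ _ _ _ _ (cov _ c1 a1)); exact: ar.2.
have dF : [disjoint cover F1 & cover F2].
  by rewrite disjoint_sym; apply: disjointWl s2 _; rewrite disjoints_subset subsetDr.
have sz F : #|F| = N -> trivIset F -> {in F, forall D, absorber i D} -> T <= #|spares F|.
  move=> cF tF aF; apply: leq_trans (ceil_mul_ge i) _; rewrite -/N -cF.
  by apply: card_spares_ge => // D /aF/absorber_spare.
have [s [t [a [b [[sS tS aW bW] [esa esb eab eta etb]]]]]] :=
  diamond_across (sz _ c1 t1 a1) (sz _ c2 t2 a2) cW.
have {sS} [D1 D1F sD] := sparesP _ _ sS; have {tS} [D2 D2F tD] := sparesP _ _ tS.
have sD1 : D1 \subset cover F1 by apply: bigcup_sup.
have sD2 : D2 \subset cover F2 by apply: bigcup_sup.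
have nW x : x \in U :\: cover F1 :\: cover F2 -> (x \in U) && (x \notin D1 :|: D2).
  rewrite !inE => /and3P[x2 x1 ->] /=; apply/norP; split.
    by apply: contra x1; apply: subsetP.
  by apply: contra x2; apply: subsetP.
have /andP[aU aD] := nW _ aW; have /andP[bU bD] := nW _ bW.
have dD : [disjoint D1 & D2] by apply: disjointWl sD1 _; apply: disjointWr dF.
exists (D1 :|: D2 :|: [set a; b]).
  rewrite !subUset !sub1set aU bU (subset_trans sD1) //=.
  by rewrite (subset_trans sD2 (subset_trans s2 (subsetDl _ _))).
have /andP[p1 q1] := a1 _ D1F; have /andP[p2 q2] := a2 _ D2F.
apply/andP; split.
  apply: leq_trans (subset_leq_card (spare_join dD aD bD sD tD esa esb eab eta etb)).
  rewrite cardsU (_ : _ :&: _ = set0) ?cards0 ?subn0; last first.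
    apply/eqP; rewrite setI_eq0; apply: disjointWl (spare_sub _) _.
    by apply: disjointWr (spare_sub _) dD.
  by rewrite expnS mul2n -addnn leq_add.
have := (leq_card_setU (D1 :|: D2) [set a; b]).1.
have := (leq_card_setU D1 D2).1; rewrite cards2; move: q1 q2.
rewrite expnS; move: #|_| #|_| #|_| #|_| (2 ^ i) (a != b) => ? ? ? ? ? []; clear; lia.
Qed.

Lemma absorbers_exist i c (U : {set G}) :
  2 ^ i <= 2 * T -> c * (3 * 2 ^ i) + (13 * i + 1) * T <= #|U| ->
  exists F, [/\ #|F| = c, trivIset F, cover F \subset U
    & {in F, forall D, absorber i D}].
Proof.
by move=> iT; apply: absorber_family => {}U; apply: absorber_exists.
Qed.

(** ** The chain of levels *)

(** One level [F] consists of a mass part [X], [Y], which deals with all but few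
    members of [Z], and a reserve [X'], [Y'], which finishes [Z] off.  The
    members of [F] that have not been used are then grouped in threes, until
    their number is again small enough for the next level. *)
Lemma level_absorbs i (Z X Y X' Y' : {set {set G}}) :
    let N := (T %/ 2 ^ i).+1 in let F := X :|: Y :|: (X' :|: Y') in
    trivIset (Z :|: F) -> [disjoint F & Z] ->
    [disjoint X & Y] -> [disjoint X' & Y'] -> [disjoint X :|: Y & X' :|: Y'] ->
    #|X| = 20 * N -> #|Y| = 20 * N -> #|Z| <= 3 * N ->
    {in F, forall D, absorber i.+1 D} ->
    {in Z, forall D, 2 ^ i <= #|spare D|} ->
    {in Z, forall D, exists2 v, v \in spare D
       & 10 * m <= deg v (spares X') /\ 10 * m <= deg v (spares Y')} ->
  exists K, [/\ K \subset Z :|: F, tiled (cover K), Z \subset K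
    & #|(Z :|: F) :\: K| < 3 * (T %/ 2 ^ i.+1).+1].
Proof.
move=> N F tH dFZ dXY dXY' dMR cX cY cZ aF aZ dZ; set H := Z :|: F.
have sM : X :|: Y \subset F by rewrite subsetUl.
have sR : X' :|: Y' \subset F by rewrite subsetUr.
have sX : X \subset F := subset_trans (subsetUl _ _) sM.
have sY : Y \subset F := subset_trans (subsetUr _ _) sM.
have sX' : X' \subset F := subset_trans (subsetUl _ _) sR.
have sY' : Y' \subset F := subset_trans (subsetUr _ _) sR.
have sFH : F \subset H by rewrite subsetUr.
have sZH : Z \subset H by rewrite subsetUl.
have mass_big (A : {set {set G}}) : #|A| = 20 * N ->
    T + #|Z| * 2 ^ i.+1 <= #|A| * 2 ^ i.+1.
  move=> ->; have := ceil_mul_ge i; rewrite -/N expnS => TN.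
  apply: leq_trans (leq_add TN (leq_mul cZ (leqnn _))) _.
  by move: {-}N (2 ^ i) => n p; clear; lia.
have [|||||| K1 [sK1 tK1 mK1]] := @tile_mass (2 ^ i.+1) Z X Y _ dXY.
- by apply: trivIsetS tH; rewrite -setUA setUS.
- by apply: disjointWl dFZ.
- by apply: disjointWl dFZ.
- by move=> D /(subsetP sM)/aF/absorber_spare.
- exact: mass_big.
- exact: mass_big.
set Z1 := Z :\: K1 in mK1.
have sZ1 : Z1 \subset Z by exact: subsetDl.
have cZ1 : #|Z1| * 2 ^ i < m.
  apply: leq_ltn_trans mK1; apply: card_spares_ge.
    by apply: trivIsetS tH; apply: subset_trans sZ1 sZH.
  by move=> D /(subsetP sZ1)/aZ.
have [|||||| K2 [sK2 tK2 mK2]] :=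
    @tile_reserve (3 * 2 ^ i.+1) (10 * m) Z1 X' Y' _ dXY'.
- by apply: trivIsetS tH; rewrite -setUA setUSS.
- by apply: disjointWl sX' _; apply: disjointWr dFZ.
- by apply: disjointWl sY' _; apply: disjointWr dFZ.
- by move=> D /(subsetP sR)/aF/absorber_card.
- by move=> D /(subsetP sZ1)/dZ.
- by rewrite expnS; move: cZ1; move: #|Z1| (2 ^ i); clear; nia.
have sK1H : K1 \subset H by apply: subset_trans sK1 _; rewrite -setUA setUS.
have sK2H : K2 \subset H by apply: subset_trans sK2 _; rewrite -setUA setUSS.
have dK : [disjoint K1 & K2].
  rewrite disjoint_sym disjoints_subset (subset_trans sK2) //.
  rewrite -setUA subUset {1}/Z1 setDE subsetIr /=.
  rewrite -disjoints_subset; apply: disjointWr sK1 _.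
  rewrite -setUA disjoint_sym disjoints_subset subUset -!disjoints_subset dMR andbT.
  by rewrite disjoint_sym; apply: disjointWl dFZ.
have tK12 := tiled_coverU tH sK1H sK2H dK tK1 tK2.
set K12 := K1 :|: K2 in tK12.
have sK12 : K12 \subset H by rewrite subUset sK1H.
have ZK : Z \subset K12.
  apply/subsetP => D DZ; rewrite inE; case: (boolP (D \in K1)) => //= DK.
  by apply: (subsetP mK2); rewrite inE DK.
have [||| K3 [sK3 tK3 cK3]] :=
    @tile_triples (2 ^ i.+1) (T %/ 2 ^ i.+1).+1 (H :\: K12).
- exact: trivIsetD.
- move=> D /setDP[/setUP[DZ|DF] DK].
    by move: DK; rewrite (subsetP ZK).
  exact/absorber_spare/aF.
- exact: ceil_mul_ge.
exists (K12 :|: K3); split.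
- by rewrite subUset sK12 (subset_trans sK3 (subsetDl _ _)).
- apply: (tiled_coverU tH sK12 _ _ tK12 tK3).
    exact: subset_trans sK3 (subsetDl _ _).
  by rewrite disjoint_sym; apply: disjointWl sK3 _; rewrite disjoints_subset subsetDr.
- by apply: subset_trans ZK (subsetUl _ _).
- by rewrite -setDDl.
Qed.

(** A set with a spare vertex has size 1 modulo 3. *)
Lemma card_cover_mod3 F : trivIset F -> {in F, forall D, 0 < #|spare D|} ->
  #|cover F| = #|F| %[mod 3].
Proof.
move=> tF aF; rewrite -(eqP tF) -sum1_card.
elim/big_rec2: _ => // D a b DF e; have /card_gt0P[x xD] := aF _ DF.
by rewrite -modnDm (spare_mod3 xD) e modnDm.
Qed.

(** Most vertices have ten times as many neighbours as it takes to find an edge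
    in a neighbourhood; the surplus pays for deletions. *)
Hypothesis low_degree : forall X,
  20 * T <= #|X| -> #|[set v | deg v X < 10 * m]| <= m.

(** Levels of sizes [2 ^ i.+1], [2 ^ i.+2] and so on, up to [T], form a set [W] that
    absorbs any not too large family of sets with [2 ^ i] spare vertices.
    They are built from the top downwards, because a member of one level must
    have a spare vertex outside the set [B] of vertices with low degree into
    the reserve of the next level.  A level takes [80 * N] absorbers of at
    most [6 * 2 ^ i] vertices, where [N * 2 ^ i <= 2 * T]: [960 * T]
    vertices. *)
Lemma absorbing_set j i (U : {set G}) :
    T <= 2 ^ (i + j) -> 960 * j * T + (13 * (i + j) + 4) * T <= #|U| ->
  exists W B : {set G}, [/\ W \subset U, #|W| <= 960 * j * T, #|B| <= 2 * m
    & forall Z, trivIset Z -> [disjoint W & cover Z] ->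
        {in Z, forall D, 2 ^ i <= #|spare D| /\ ~~ (spare D \subset B)} ->
        #|Z| <= 3 * (T %/ 2 ^ i).+1 -> 3 %| #|W :|: cover Z| ->
        tiled (W :|: cover Z)].
Proof.
(* With [T] spare vertices in each set, any three can be grouped, and the
   count modulo 3 excludes one or two left over. *)
have top k (V : {set G}) l : T <= 2 ^ k ->
    exists W B : {set G}, [/\ W \subset V, #|W| <= l, #|B| <= 2 * m
    & forall Z, trivIset Z -> [disjoint W & cover Z] ->
        {in Z, forall D, 2 ^ k <= #|spare D| /\ ~~ (spare D \subset B)} ->
        #|Z| <= 3 * (T %/ 2 ^ k).+1 -> 3 %| #|W :|: cover Z| ->
        tiled (W :|: cover Z)].
  move=> Tk; exists set0, set0; rewrite sub0set cards0; split=> // Z tZ _ aZ _.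
  rewrite set0U => dZ.
  have [||| K [sK tK cK]] := @tile_triples (2 ^ k) 1 Z => //.
  - by move=> D /aZ[].
  - by rewrite mul1n.
  have tZK : trivIset (Z :\: K) by exact: trivIsetD.
  have dK : [disjoint K & Z :\: K].
    by rewrite disjoint_sym disjoints_subset subsetDr.
  have eZ : cover Z = cover K :|: cover (Z :\: K).
    by rewrite -coverU -{1}(setIidPr sK) setID.
  have : 3 %| #|cover (Z :\: K)|.
    rewrite -(dvdn_addr _ (tiled_dvd tK)) -card_disjointU -?eZ //.
    exact: disjoint_cover tZ sK (subsetDl _ _) dK.
  rewrite /dvdn card_cover_mod3 // => [|D]; last first.
    rewrite inE => /andP[_ /aZ[lD _]]; apply: leq_trans lD.
    by rewrite expn_gt0.
  rewrite modn_small ?muln1 // cards_eq0 => /eqP e0.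
  by rewrite eZ e0 /cover big_set0 setU0.
elim: j i U => [|j IHj] i U Tij cU.
  by apply: top; rewrite addn0 in Tij.
have [Ti|iT] := leqP T (2 ^ i); first exact: top.
have {}iT := ltnW iT; set N := (T %/ 2 ^ i).+1.
rewrite addnS -addSn in Tij cU.
have [|W [B [sW cW cB absW]]] := IHj i.+1 U Tij.
  apply: leq_trans cU; rewrite leq_add2r leq_mul2r leq_mul2l leqnSn.
  by rewrite !orbT.
have i2T : 2 ^ i.+1 <= 2 * T by rewrite expnS leq_pmul2l.
have N2 : N * 2 ^ i <= 2 * T := ceil_mul_le iT.
have N960 : 80 * N * (3 * 2 ^ i.+1) <= 960 * T.
  by rewrite expnS; move: N2; move: {-}N (2 ^ i) => n p; clear; nia.
have [|F [cF tF sF aF]] := @absorbers_exist i.+1 (80 * N) (U :\: (W :|: B)) i2T.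
  rewrite cardsD leq_subRL; last exact: subset_leq_card (subsetIl _ _).
  apply: leq_trans cU.
  have c1 : #|U :&: (W :|: B)| <= 960 * j * T + 2 * T.
    apply: leq_trans (subset_leq_card (subsetIr _ _)) _.
    apply: leq_trans (leq_card_setU W B).1 (leq_add cW (leq_trans cB _)).
    by rewrite leq_mul2l.
  apply: leq_trans (leq_add c1 (leq_add N960 (leqnn _))) _.
  have arith t : 960 * j * t + 2 * t + (960 * t + (13 * i.+1 + 1) * t)
      <= 960 * j.+1 * t + (13 * (i.+1 + j) + 4) * t by clear; nia.
  exact: arith.
have F80 : #|F| = 2 * (2 * (20 * N)) by rewrite cF !mulnA.
have [F1 [F2 [eF dF c1 c2]]] := halve F80.
have [X [Y [eF1 dXY cX cY]]] := halve c1.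
have [X' [Y' [eF2 dXY' cX' cY']]] := halve c2.
move: eF dF; rewrite -eF1 -eF2 => eF dF {c1 c2}.
pose low A := [set v | deg v (spares A) < 10 * m].
have low_small (A : {set {set G}}) : A \subset F -> #|A| = 20 * N -> #|low A| <= m.
  move=> sA cA; apply: low_degree.
  have le_sp : #|A| * 2 ^ i.+1 <= #|spares A|.
    apply: card_spares_ge (trivIsetS sA tF) _ => D.
    by move=> /(subsetP sA)/aF/absorber_spare.
  apply: leq_trans le_sp; rewrite cA expnS; have := ceil_mul_ge i; rewrite -/N.
  by move: {-}N (2 ^ i) => n p; clear; nia.
have sX' : X' \subset F by rewrite -eF; apply: subset_trans (subsetUl _ _) (subsetUr _ _).
have sY' : Y' \subset F by rewrite -eF; apply: subset_trans (subsetUr _ _) (subsetUr _ _).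
exists (W :|: cover F), (low X' :|: low Y'); split.
- by rewrite subUset sW (subset_trans sF (subsetDl _ _)).
- apply: leq_trans (leq_card_setU _ _).1 _; rewrite mulnSr mulnDl leq_add //.
  apply: leq_trans N960; rewrite -cF; apply: card_cover_le => D.
  by move/aF/absorber_card.
- apply: leq_trans (leq_card_setU _ _).1 _.
  by rewrite mul2n -addnn leq_add // low_small.
move=> Z tZ; rewrite disjoints_subset subUset -!disjoints_subset.
case/andP=> dWZ dFZ aZ cZ d3.
have sp_gt0 k D : 2 ^ k <= #|spare D| -> 0 < #|spare D|.
  by apply: leq_trans; rewrite expn_gt0.
have dFZ' : [disjoint F & Z].
  rewrite disjoints_subset; apply/subsetP=> D DF; rewrite inE; apply/negP => DZ.
  have /card_gt0P[x xD] := sp_gt0 _ _ (absorber_spare (aF _ DF)).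
  have {}xD := subsetP (spare_sub D) _ xD.
  have xF : x \in cover F by apply/bigcupP; exists D.
  have xZ : x \in cover Z by apply/bigcupP; exists D.
  by rewrite (disjointFr dFZ xF) in xZ.
have tH : trivIset (Z :|: F).
  by apply: trivIsetU => //; rewrite disjoint_sym.
have [|||||||||||K [sK tK ZK cK]] := @level_absorbs i Z X Y X' Y'; rewrite ?eF //.
- by move=> D /aZ[].
- move=> D /aZ[_ /subsetPn[v vD]]; rewrite !inE negb_or -!leqNgt => /andP[h1 h2].
  by exists v.
rewrite eF in sK cK; set Z' := (Z :|: F) :\: K in cK.
have sZ' : Z' \subset F.
  apply/subsetP=> D /setDP[/setUP[DZ|//]]; first by rewrite (subsetP ZK).
have dKZ : [disjoint Z' & K] by rewrite disjoints_subset subsetDr.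
have cZK : [disjoint cover Z' & cover K].
  by apply: disjoint_cover tH _ sK dKZ; apply: subsetDl.
have eW : W :|: cover F :|: cover Z = W :|: cover Z' :|: cover K.
  rewrite -!setUA -!coverU; congr (_ :|: cover _).
  by rewrite setUC -[LHS](setID _ K) (setIidPr sK) setUC.
have dWF : [disjoint W & cover F].
  rewrite disjoint_sym; apply: disjointWl sF _.
  rewrite disjoints_subset; apply/subsetP=> x; rewrite !inE negb_or.
  by case/andP=> /andP[].
have dWK : [disjoint W :|: cover Z' & cover K].
  rewrite disjoints_subset subUset -!disjoints_subset cZK andbT.
  apply: disjointWr (cover_subset sK) _; rewrite coverU.
  rewrite disjoint_sym disjoints_subset subUset -!disjoints_subset.
  by rewrite !(disjoint_sym _ W) dWZ.
rewrite eW; apply: tiledU => //; apply: absW => //.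
- exact: trivIsetS tF.
- by apply: disjointWr (cover_subset sZ') dWF.
- move=> D /(subsetP sZ') DF; split; first exact/absorber_spare/aF.
  have /card_gt0P[x xD] := sp_gt0 _ _ (absorber_spare (aF _ DF)).
  apply/subsetPn; exists x => //; have {}xD := subsetP (spare_sub D) _ xD.
  have : x \in cover F by apply/bigcupP; exists D.
  by move/(subsetP sF); rewrite !inE negb_or => /andP[/andP[]].
- exact: ltnW.
- rewrite eW in d3; move: d3.
  by rewrite card_disjointU // dvdn_addl // tiled_dvd.
Qed.

(** ** Tiling a pseudorandom graph *)

(** Greedily: each of the [#|B|] steps deletes three vertices, so a vertex of [B]
    keeps [m] neighbours in [Y] and there is an edge among them. *)
Lemma tile_around (B Y : {set G}) :
    {in B, forall v, 3 * #|B| + m <= deg v Y} ->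
  exists Q, [/\ tiled Q, B \subset Q, Q \subset B :|: Y & #|Q| <= 3 * #|B|].
Proof.
have [n] := ubnP #|B|; elim: n B Y => // n IHn B Y Bn hB.
have [->|[v vB]] := set_0Vmem B.
  by exists set0; rewrite tiled0 !sub0set cards0.
have hv := leq_trans (leq_addl _ _) (hB _ vB).
have [x [y []]] := edge_between hv hv.
rewrite !inE => /andP[xY evx] /andP[yY evy] exy.
set S := [set v; x; y]; have tS : tiled S by apply: tiled3.
have vS : v \in S by rewrite !inE eqxx.
have cS : #|S| <= 3.
  by rewrite (leq_trans (leq_card_setU _ _).1) // cards1 addn1 ltnS cards2;
    case: (_ != _).
have cB : #|B :\: S| < #|B|.
  apply: proper_card; rewrite properE subsetDl; apply/subsetPn; exists v => //.
  by rewrite in_setD vS.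
have [||Q [tQ sB sQ cQ]] := IHn (B :\: S) (Y :\: S).
- by rewrite -ltnS (leq_trans _ Bn).
- move=> u; rewrite inE => /andP[_ /hB hu].
  have h1 := leq_trans hu (leq_trans (deg_leD u Y S) (leq_add (leqnn _) cS)).
  rewrite -(leq_add2r 3); apply: leq_trans h1.
  by rewrite addnAC leq_add2r -(mulnDr 3 _ 1) leq_mul2l addn1 cB.
have dQS : [disjoint Q & S].
  by apply: disjointWl sQ _; rewrite -setDUl disjoints_subset subsetDr.
exists (Q :|: S); split.
- exact: tiledU.
- apply/subsetP=> u uB; rewrite in_setU; case: (boolP (u \in S)) => [|uS].
    by rewrite orbT.
  by rewrite orbF (subsetP sB) // in_setD uS.
- rewrite subUset (subset_trans sQ (setUSS (subsetDl _ _) (subsetDl _ _))) /=.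
  by rewrite /S !subUset !sub1set !inE vB xY yY !orbT.
- rewrite (leq_trans (leq_card_setU _ _).1) //.
  apply: leq_trans (leq_add cQ cS) _.
  by rewrite -(mulnDr 3 _ 1) leq_mul2l addn1 cB.
Qed.

Lemma tile_greedily (U : {set G}) :
  exists Q, [/\ tiled Q, Q \subset U & #|U :\: Q| < T].
Proof.
have [n] := ubnP #|U|; elim: n U => // n IHn U Un.
have [UT|TU] := ltnP #|U| T; first by exists set0; rewrite tiled0 sub0set setD0.
have [x [y [z [[xU yU zU] [exy exz eyz]]]]] :=
  triangle_across TU TU (leq_trans m_le_T TU).
set S := [set x; y; z]; have tS : tiled S by apply: tiled3.
have [|Q [tQ sQ cQ]] := IHn (U :\: S).
  rewrite -ltnS; apply: leq_trans Un; rewrite ltnS; apply: proper_card.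
  rewrite properE subsetDl; apply/subsetPn; exists x => //.
  by rewrite !inE eqxx.
exists (S :|: Q); split; last by rewrite -setDDl.
- apply: tiledU => //; rewrite disjoint_sym; apply: disjointWl sQ _.
  by rewrite disjoints_subset subsetDr.
- by rewrite subUset /S !subUset !sub1set xU yU zU (subset_trans sQ (subsetDl _ _)).
Qed.

(** Besides the absorbing set [W], a set [V0] is reserved into which almost all
    vertices have large degree.  The exceptions are tiled first ([Q0]); the
    vertices that [W] cannot absorb are tiled with two vertices of [V0] each
    ([Q1]); the rest is tiled greedily ([Q2]) up to fewer than [T] vertices,
    which are absorbed as singletons. *)
Lemma pseudorandom_tiled k :
    3 %| #|G| -> T <= 2 ^ k -> (973 * k + 30) * T <= #|G| ->
    (forall v, 10 * m <= deg v [set: G]) ->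
  tiled [set: G].
Proof.
move=> d3 Tk nT degT.
have [|V0 _ cV0] := @subset_of_card _ [set: G] (20 * T).
  by rewrite cardsT; apply: leq_trans nT; rewrite leq_mul2r; apply/orP; right; lia.
set B0 := [set v | deg v V0 < 10 * m].
have cB0 : #|B0| <= m by apply: low_degree; rewrite cV0.
have [|Q0 [tQ0 sBQ0 _ cQ0]] := @tile_around B0 [set: G].
  move=> v _; apply: leq_trans (degT v).
  by move: cB0; move: #|B0| => b; clear; lia.
have {}cQ0 : #|Q0| <= 3 * m by apply: leq_trans cQ0 _; rewrite leq_mul2l.
pose U := ~: (V0 :|: Q0).
have [||W [B [sW _ cB absW]]] := @absorbing_set k 0 U => //.
  rewrite /U cardsCs setCK leq_subRL ?max_card //.
  apply: leq_trans nT; apply: leq_trans (leq_add (leq_card_setU _ _).1 (leqnn _)) _.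
  by move: cQ0 m_le_T; rewrite cV0; move: #|Q0| {-}T {-}m => q t r; clear; nia.
set B1 := B :\: (W :|: Q0).
have [|Q1 [tQ1 sB1 sQ1 _]] := @tile_around B1 (V0 :\: Q0).
  move=> v; rewrite inE in_setU negb_or => /andP[/andP[_ vQ0] vB].
  have : v \notin B0 by apply: contra vQ0; apply: subsetP.
  rewrite inE -leqNgt => dv; have := leq_trans dv (deg_leD v V0 Q0).
  have := subset_leq_card (subsetDl B (W :|: Q0)); rewrite -/B1.
  move: cB cQ0; move: #|_| #|_| #|_| (deg _ _) {-}m; clear; lia.
set R := ~: (W :|: Q0 :|: Q1).
have [Q2 [tQ2 sQ2 cL]] := tile_greedily R.
set L := R :\: Q2 in cL.
have sWU x : x \in W -> (x \notin V0) && (x \notin Q0).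
  by move/(subsetP sW); rewrite !inE negb_or.
have dW1 : [disjoint W & Q1].
  rewrite disjoint_sym; apply: disjointWl sQ1 _; rewrite disjoints_subset.
  apply/subsetP=> x; rewrite !inE negb_or; case: (boolP (x \in W)) => // /sWU.
  by case/andP=> /negPf-> /negPf->; rewrite andbF.
have d01 : [disjoint Q0 & Q1].
  rewrite disjoint_sym; apply: disjointWl sQ1 _; rewrite disjoints_subset.
  apply/subsetP=> x; rewrite !inE negb_or; case: (x \in Q0) => //.
  by rewrite andbF.
have dW0 : [disjoint W & Q0].
  by rewrite disjoints_subset; apply/subsetP=> x /sWU /andP[_]; rewrite inE.
have d2 : [disjoint W :|: Q0 :|: Q1 & Q2].
  by rewrite disjoint_sym; apply: disjointWl sQ2 _; rewrite disjoints_subset.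
have tQ : tiled (Q0 :|: Q1 :|: Q2).
  apply: tiledU => //; last exact: tiledU.
  by apply: disjointWl d2; rewrite -setUA subsetUr.
pose Z := [set [set x] | x in L].
have inZ D : D \in Z -> exists2 x, x \in L & D = [set x] by case/imsetP => x; exists x.
have cZ : cover Z = L.
  rewrite cover_imset; apply/setP=> x; apply/bigcupP/idP => [[y yL]|xL].
    by rewrite inE => /eqP->.
  by exists x; rewrite ?set11.
have dWL : [disjoint W & L].
  rewrite disjoint_sym disjoints_subset; apply/subsetP=> x.
  by rewrite !inE !negb_or => /andP[_ /andP[/andP[]]].
have dL : [disjoint W :|: L & Q0 :|: Q1 :|: Q2].
  rewrite disjoint_sym disjoints_subset; apply/subsetP=> x.
  rewrite !inE !negb_or !negb_and !negbK.
  case/orP=> [/orP[]|] xQ; rewrite xQ ?orbT /= ?andbT.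
  - by rewrite (disjointFl dW0 xQ).
  - by rewrite (disjointFl dW1 xQ).
  - by rewrite (disjointFl (disjointWl _ d2) xQ) // -setUA subsetUl.
have eT : [set: G] = W :|: L :|: (Q0 :|: Q1 :|: Q2).
  apply/setP=> x; rewrite !inE; case: (x \in W) => //=.
  by case: (x \in Q0) => //=; case: (x \in Q1); case: (x \in Q2).
rewrite eT; apply: tiledU => //; rewrite -cZ; apply: absW.
- apply/trivIsetP => _ _ /inZ[x xL ->] /inZ[y yL ->] nxy.
  by rewrite disjoints1 inE; apply: contraNneq nxy => ->.
- by rewrite cZ.
- move=> _ /inZ[x xL ->]; rewrite spare1 cards1 sub1set; split=> //.
  move: xL; rewrite !inE !negb_or => /andP[_ /andP[/andP[xW x0] x1]].
  apply: contra x1 => xB; apply: (subsetP sB1).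
  by rewrite !inE negb_or xW x0.
- rewrite divn1 (leq_trans (leq_imset_card _ _)) //.
  by move: cL; move: {-}T #|L|; clear; lia.
- have := d3; rewrite -cardsT eT card_disjointU // cZ.
  by rewrite dvdn_addl // tiled_dvd.
Qed.

End Families.

(** * The spectrum of a real symmetric matrix *)

Lemma char_poly_conj (K : comUnitRingType) n (P A : 'M[K]_n) :
  P \in unitmx -> char_poly (invmx P *m A *m P) = char_poly A.
Proof.
move=> uP; rewrite /char_poly /char_poly_mx !map_mxM.
have PP : map_mx (@polyC K) (invmx P) *m map_mx (@polyC K) P = 1%:M.
  by rewrite -map_mxM mulVmx // map_mx1.
have -> : 'X%:M - map_mx (@polyC K) (invmx P) *m map_mx (@polyC K) A *m
    map_mx (@polyC K) P =
    map_mx (@polyC K) (invmx P) *m ('X%:M - map_mx (@polyC K) A) *m map_mx (@polyC K) P.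
  rewrite mulmxBr mulmxBl; congr (_ - _).
  by rewrite scalar_mxC -mulmxA PP mulmx1.
rewrite !det_mulmx mulrAC -mulrA -[RHS]mul1r -[1](@det1 _ n) -PP det_mulmx.
by rewrite -!mulrA [_ * \det (_ - _)]mulrC.
Qed.

Section Spectrum.
Local Open Scope sesquilinear_scope.

Lemma conjtrE (K : numClosedFieldType) m n (M : 'M[K]_(m, n)) i j :
  M^t* i j = (M j i)^*.
Proof. by rewrite !mxE. Qed.

Variables (R : realType) (n : nat) (A : 'M[R]_n).
Hypothesis symA : A^T = A.
Local Notation toC := (real_complex R).
Local Notation AC := (map_mx toC A).

(** Over the complex numbers a real symmetric matrix is hermitian, hence
    unitarily diagonalizable with real diagonal. *)
Lemma complexified_hermitian : AC \is hermsymmx.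
Proof.
apply: realsym_hermsym.
  apply/is_hermitianmxP; rewrite expr0 scale1r map_mx_id // map_trmx.
  by rewrite symA.
apply/mxOverP => i j; rewrite mxE; apply/complex_realP; by exists (A i j).
Qed.

Definition eigval (i : 'I_n) : R := complex.Re (spectral_diag AC 0 i).

Lemma eigvalE i : spectral_diag AC 0 i = toC (eigval i).
Proof.
rewrite /eigval RRe_real //.
exact: (mxOverP (hermitian_spectral_diag_real complexified_hermitian)).
Qed.

Lemma spectral_decomp :
  AC = (spectralmx AC)^t* *m diag_mx (spectral_diag AC) *m spectralmx AC.
Proof.
have /hermitian_normalmx /orthomx_spectralP {1}-> := complexified_hermitian.
by rewrite invmx_unitary ?spectral_unitarymx.
Qed.

Lemma char_poly_eigval : char_poly A = \prod_i ('X - (eigval i)%:P).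
Proof.
apply: (@map_poly_inj R _ toC); rewrite map_char_poly.
have /hermitian_normalmx /orthomx_spectralP {1}-> := complexified_hermitian.
rewrite char_poly_conj ?spectral_unit // char_poly_trig ?diag_mx_is_trig //.
rewrite rmorph_prod; apply: eq_bigr => i _.
by rewrite rmorphB /= map_polyX map_polyC /= !mxE eqxx mulr1n eigvalE.
Qed.

(** The characteristic polynomial splits over the reals, hence the sorted list
    of its roots is the list of all diagonal entries. *)
Lemma eigenvalues_eigval :
  eigenvalues A = sort (fun x y => y <= x) [seq eigval i | i <- enum 'I_n].
Proof.
apply: eigenvalues_prod; rewrite char_poly_eigval big_map big_enum.
by [].
Qed.

(** The coordinates of a vector in an orthonormal basis of eigenvectors. *)
Definition coords (x : 'rV[R]_n) : 'rV[R[i]]_n :=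
  map_mx toC x *m (spectralmx AC)^t*.

Lemma coords_dot x y : (coords x *m (coords y)^t*) 0 0 = toC ((x *m y^T) 0 0).
Proof.
rewrite /coords trmx_mul map_mxM trmxCK mulmxA.
rewrite mulmxKtV ?spectral_unitarymx //.
rewrite !mxE rmorph_sum; apply: eq_bigr => k _; rewrite !mxE rmorphM.
by congr (_ * _); exact: conjc_real.
Qed.

Lemma coords_mul x i : coords (x *m A) 0 i = coords x 0 i * toC (eigval i).
Proof.
rewrite /coords map_mxM {1}spectral_decomp !mulmxA.
rewrite mulmxtVK ?spectral_unitarymx //.
by rewrite mul_mx_diag mxE eigvalE.
Qed.

Lemma coords_norm x : \sum_i `|coords x 0 i| ^+ 2 = toC (\sum_i x 0 i ^+ 2).
Proof.
have -> : \sum_i x 0 i ^+ 2 = (x *m x^T) 0 0.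
  by rewrite mxE; apply: eq_bigr => i _; rewrite mxE.
rewrite -coords_dot mxE; apply: eq_bigr => i _.
by rewrite !mxE normCK.
Qed.

(** [J] has eigenvalue [d > lam], and only one basis vector has an eigenvalue
    above [lam]; hence [J] is a multiple of it.  A vector orthogonal to [J]
    has no component along it, and every other component is multiplied by a
    factor of absolute value at most [lam]. *)
Lemma norm_image_le (lam d : R) (J x : 'rV[R]_n) :
    J *m A = d *: J -> J != 0 -> 0 <= lam < d ->
    (forall i j, lam < `|eigval i| -> lam < `|eigval j| -> i = j) ->
    x *m J^T = 0 ->
  \sum_i (x *m A) 0 i ^+ 2 <= lam ^+ 2 * \sum_i x 0 i ^+ 2.
Proof.
move=> JA J0 /andP[lam0 lamd] uniq_large xJ.
have eJ i : coords J 0 i != 0 -> eigval i = d.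
  move=> ci; have := coords_mul J i; rewrite JA.
  have -> : coords (d *: J) 0 i = toC d * coords J 0 i.
    by rewrite /coords map_mxZ -scalemxAl mxE.
  by rewrite mulrC => /(mulfI ci) /complexI.
have [i0 ci0] : exists i0, coords J 0 i0 != 0.
  apply/existsP; apply: contraNT J0; rewrite negb_exists => /forallP c0.
  have : toC (\sum_i J 0 i ^+ 2) == 0.
    rewrite -coords_norm big1 // => i _; have := c0 i; rewrite negbK => /eqP->.
    by rewrite normr0 expr0n.
  rewrite -(rmorph0 toC) (inj_eq (@complexI R)) psumr_eq0 => [/allP J0|i _].
    apply/eqP/rowP => i; have := J0 i (mem_index_enum i).
    by rewrite sqrf_eq0 mxE => /eqP.
  exact: sqr_ge0.
(* [i0] is the index of the large eigenvalue. *)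
have small i : i != i0 -> `|eigval i| <= lam.
  apply: contraNT; rewrite -ltNge => li; apply/eqP/uniq_large => //.
  by rewrite eJ // (lt_le_trans lamd) // ler_norm.
have xi0 : coords x 0 i0 = 0.
  have : (coords x *m (coords J)^t*) 0 0 = 0 by rewrite coords_dot xJ mxE rmorph0.
  rewrite mxE (bigD1 i0) //= big1.
    rewrite addr0 conjtrE => /eqP; rewrite mulf_eq0 conjC_eq0 => /orP[/eqP //|].
    by rewrite (negPf ci0).
  move=> i /small si; rewrite conjtrE.
  have [->|/eJ ei] := eqVneq (coords J 0 i) 0; first by rewrite rmorph0 mulr0.
  by move: si; rewrite ei leNgt (lt_le_trans lamd) // ler_norm.
rewrite -(@lecR R) rmorphM /= -!coords_norm mulr_sumr.
apply: ler_sum => i _; rewrite coords_mul normrM exprMn mulrC.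
have [->|/small si] := eqVneq i i0; first by rewrite xi0 normr0 expr0n !mulr0.
apply: ler_wpM2r; first exact: exprn_ge0.
rewrite normc_def /= expr0n addr0 sqrtr_sqr -rmorphXn /= lecR.
by rewrite lerXn2r // nnegrE.
Qed.

End Spectrum.

(** * Degrees into a set *)

(** All entries except the first lie between the last one and the second. *)
Lemma count_large_le1 (R : realType) (s : seq R) :
    sorted (fun x y => y <= x) s ->
  (count (fun x => Num.max `|nth 0 s 1| `|nth 0 s (size s).-1| < `|x|)%R s <= 1)%N.
Proof.
case: s => // x0 s ss; set l := Num.max _ _.
rewrite -[1%N]addn0 leq_add ?leq_b1 // leqn0 -[_ == _]negbK -lt0n -has_count.
apply/hasPn => x xs; rewrite -leNgt.
have [j js <-] := nthP 0 xs.
have tr : transitive (fun x y : R => y <= x) by move=> a b c ab bc; apply: le_trans ab.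
have mono := @sorted_leq_nth _ _ tr (@lexx _ R) 0 _ ss.
have h1 : nth 0 s j <= nth 0 (x0 :: s) 1.
  by apply: (mono 1%N j.+1) => //; rewrite inE /= ltnS (leq_trans _ js).
have h2 : nth 0 (x0 :: s) (size (x0 :: s)).-1 <= nth 0 s j.
  by apply: (mono j.+1 (size s)); rewrite ?inE //= ?ltnS.
rewrite /l le_max; have [p|p] := leP 0 (nth 0 s j).
  by rewrite (ger0_norm p) (ger0_norm (le_trans p h1)) h1.
apply/orP; right; rewrite (ltr0_norm p) (ler0_norm (le_trans h2 (ltW p))).
by rewrite lerN2.
Qed.

Section Expansion.
Variables (R : realType) (G : sgraph).
Local Notation A := (adjacency_mx R G).
Local Notation lambda := (second_eigenvalue R G).
Implicit Types X Y : {set G}.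

Lemma adjacency_sym : A^T = A.
Proof. by apply/matrixP => i j; rewrite !mxE edge_sym. Qed.

(** Counted with multiplicity, at most one eigenvalue exceeds [lambda] in
    absolute value. *)
Lemma second_eigenvalue_uniq i j :
  lambda < `|eigval A i| -> lambda < `|eigval A j| -> i = j.
Proof.
move=> hi hj.
have tot : total (fun x y : R => y <= x) by move=> x y; exact: le_total.
have := count_large_le1 (sort_sorted tot [seq eigval A i | i <- enum 'I_#|G|]).
rewrite -eigenvalues_eigval; last exact: adjacency_sym.
rewrite (_ : size (eigenvalues A) = #|G|); last first.
  rewrite eigenvalues_eigval ?adjacency_sym // size_sort size_map.
  by rewrite size_enum_ord.
rewrite -/lambda eigenvalues_eigval ?adjacency_sym //.
rewrite (permP (permEl (perm_sort _ _))) count_map => c1.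
have : (#|[pred k | (lambda < `|eigval A k|)%R]| <= 1)%N.
  by apply: leq_trans c1; rewrite -size_filter cardE enumT.
by move/card_le1_eqP; apply; rewrite inE.
Qed.

Lemma second_eigenvalue_ge0 : 0 <= lambda.
Proof. by rewrite /second_eigenvalue le_max normr_ge0. Qed.

Lemma sum_enum_val (F : G -> R) : \sum_(i < #|G|) F (enum_val i) = \sum_v F v.
Proof.
rewrite (reindex (@enum_val G G)) //=.
exact/onW_bij/enum_val_bij.
Qed.

Lemma degE v X : (deg v X)%:R = \sum_(u in X) (edge v u)%:R :> R.
Proof.
rewrite /deg -sum1_card natr_sum (eq_bigl (fun u => (u \in X) && edge v u)).
  by rewrite big_mkcondr; apply: eq_bigr => u _; case: (edge v u).
by move=> u; rewrite inE.
Qed.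

(** Subtracting the mean from the indicator vector of [X] makes it orthogonal to
    the constants; its image under the adjacency matrix lists the deviations
    of the degrees into [X] from their mean, and [norm_image_le] applies. *)
Lemma degree_variance d X : regular G d -> lambda < d%:R ->
  \sum_v ((deg v X)%:R - d%:R / #|G|%:R * #|X|%:R) ^+ 2 <= lambda ^+ 2 * #|X|%:R.
Proof.
move=> regG ld; have [G0|G0] := posnP #|G|.
  rewrite big1 => [|v _]; first by apply: mulr_ge0; rewrite ?sqr_ge0.
  by have := card0_eq G0 v; rewrite inE.
set n : R := #|G|%:R; have n0 : n != 0 by rewrite pnatr_eq0 -lt0n.
set q := #|X|%:R / n.
pose x : 'rV[R]_#|G| := \row_j ((enum_val j \in X)%:R - q).
have sumX : \sum_v (v \in X)%:R = #|X|%:R :> R.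
  by rewrite -sum1_card natr_sum [RHS]big_mkcond; apply: eq_bigr => v _; case: (v \in X).
have sumq (c : R) : \sum_(v : G) c = n * c by rewrite sumr_const mulr_natl.
have sumA j : \sum_i A i j = d%:R.
  rewrite -(regG (enum_val j)) -[RHS]/((#|_|)%:R).
  under eq_bigr do rewrite mxE.
  rewrite (sum_enum_val (fun u => (edge u (enum_val j))%:R)) -sum1_card natr_sum.
  rewrite [RHS]big_mkcond; apply: eq_bigr => u _; rewrite inE edge_sym.
  by case: (edge _ _).
have := @norm_image_le R _ A adjacency_sym lambda d%:R (const_mx 1) x.
have -> : \sum_i (x *m A) 0 i ^+ 2 =
    \sum_v ((deg v X)%:R - d%:R / n * #|X|%:R) ^+ 2.
  rewrite -sum_enum_val; apply: eq_bigr => j _; congr (_ ^+ 2).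
  rewrite mxE; under eq_bigr do rewrite mxE mulrBl.
  rewrite sumrB -mulr_sumr sumA; congr (_ - _); last by rewrite /q; ring.
  rewrite degE [RHS]big_mkcond -sum_enum_val.
  apply: eq_bigr => i _; rewrite mxE edge_sym.
  by case: ifP => _; rewrite ?mul1r ?mul0r.
move=> bound; apply: le_trans (bound _ _ _ _ _) _.
- apply/rowP => j; rewrite !mxE mulr1 -(sumA j); apply: eq_bigr => i _.
  by rewrite mxE mul1r.
- apply/eqP => /rowP/(_ (Ordinal G0)); rewrite !mxE => /eqP.
  by rewrite oner_eq0.
- by rewrite second_eigenvalue_ge0.
- exact: second_eigenvalue_uniq.
- apply/matrixP => i j; rewrite !mxE.
  under eq_bigr do rewrite !mxE mulr1.
  rewrite (sum_enum_val (fun v => (v \in X)%:R - q)) sumrB sumX sumq.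
  by rewrite /q mulrCA divff // mulr1 subrr.
apply: ler_wpM2l; first exact: sqr_ge0.
have -> : \sum_i x 0 i ^+ 2 = \sum_v ((v \in X)%:R * (1 - q *+ 2) + q ^+ 2).
  rewrite -sum_enum_val; apply: eq_bigr => i _; rewrite mxE.
  by case: (_ \in _) => /=; ring.
rewrite big_split /= -mulr_suml sumX sumq.
have -> : n * q ^+ 2 = #|X|%:R * q by rewrite /q; field.
rewrite -mulrDr ler_piMr //.
have : 0 <= q by rewrite /q divr_ge0.
by rewrite mulr2n; lra.
Qed.

End Expansion.

(** * From small variance to edges, triangles and diamonds *)

Section Pseudorandomness.
Variables (R : realType) (G : sgraph) (p mu : R) (T m : nat).
Implicit Types (X Y : {set G}).
Local Notation a := (p * mu).

Hypothesis p_gt0 : 0 < p.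
Hypothesis p_le1 : p <= 1.
Hypothesis G_gt0 : (0 < #|G|)%N.
(** The quantity [p * a] stands for a bound on the second eigenvalue. *)
Hypothesis variance : forall X,
  \sum_v ((deg v X)%:R - p * #|X|%:R) ^+ 2 <= (p * a) ^+ 2 * #|X|%:R.
Hypothesis mu_gt0 : 0 < mu.
Hypothesis T_gt : 6 * mu < T%:R.
Hypothesis m_gt : 4 * a < m%:R.
Hypothesis m_le : m%:R <= 4 * a + 1.

Let a_gt0 : 0 < a. Proof. by rewrite mulr_gt0. Qed.
Let a_le_mu : a <= mu. Proof. by rewrite ler_piMl // ltW. Qed.

(** A vertex is not adjacent to itself, so its degree into its own singleton
    deviates from the mean by [p]. *)
Lemma scale_ge1 : 1 <= a.
Proof.
have /card_gt0P[v _] := G_gt0.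
have := variance [set v]; rewrite cards1 mulr1 (bigD1 v) //=.
have -> : deg v [set v] = 0%N.
  by apply/eqP; rewrite cards_eq0 -subset0; apply/subsetP => u;
     rewrite !inE => /andP[/eqP->]; rewrite edge_irr.
rewrite mulr1 sub0r sqrrN => h.
have : p ^+ 2 <= (p * a) ^+ 2.
  by apply: le_trans h; rewrite lerDl sumr_ge0 // => u _; apply: sqr_ge0.
have p0 := ltW p_gt0; have pa0 := mulr_ge0 p0 (ltW a_gt0).
rewrite ler_pXn2r ?nnegrE // => h2.
by rewrite -(ler_pM2l p_gt0) mulr1.
Qed.

(** Every vertex of [Y] contributes at least [(p * #|X| / 2) ^ 2] to the
    variance. *)
Lemma few_low X Y : {in Y, forall v, 2 * (deg v X)%:R <= p * #|X|%:R} ->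
  #|Y|%:R * #|X|%:R <= 4 * a ^+ 2.
Proof.
move=> lowY; have [->|X0] := posnP #|X|.
  by rewrite mulr0 mulr_ge0 // sqr_ge0.
have x0 : 0 < #|X|%:R :> R by rewrite ltr0n.
have h : #|Y|%:R * (p * #|X|%:R / 2) ^+ 2 <= (p * a) ^+ 2 * #|X|%:R.
  apply: le_trans (variance X); rewrite mulr_natl -sumr_const.
  rewrite [leLHS]big_mkcond; apply: ler_sum => v _.
  case: ifP => [/lowY low|_]; last exact: sqr_ge0.
  rewrite -[leRHS]sqrrN opprB lerXn2r ?nnegrE //; last by lra.
    by rewrite divr_ge0 // mulr_ge0 // ltW.
  by rewrite subr_ge0; have := ler0n R (deg v X); lra.
have c0 : 0 < p ^+ 2 * #|X|%:R / 4 by rewrite divr_gt0 // mulr_gt0 // exprn_gt0.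
rewrite -(ler_pM2l c0); move: h; set x : R := #|X|%:R; set y : R := #|Y|%:R.
by rewrite [X in X <= _ -> _](_ : _ = p ^+ 2 * x / 4 * (y * x)); [|by field];
   rewrite [X in _ <= X -> _](_ : _ = p ^+ 2 * x / 4 * (4 * a ^+ 2)); [|by field].
Qed.

Definition low X : {set G} := [set v | 2 * (deg v X)%:R <= p * #|X|%:R].

Lemma lowPn v X : v \notin low X -> p * #|X|%:R < 2 * (deg v X)%:R.
Proof. by rewrite inE -ltNge. Qed.

Lemma card_low X : 6 * mu <= #|X|%:R -> 3 * #|low X|%:R <= 2 * a.
Proof.
move=> hX; have h : #|low X|%:R * #|X|%:R <= 4 * a ^+ 2.
  by apply: few_low => v; rewrite inE.
rewrite -(ler_pM2r mu_gt0); have l0 := ler0n R #|low X|.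
have h1 : #|low X|%:R * (6 * mu) <= #|low X|%:R * #|X|%:R by rewrite ler_wpM2l.
have h2 : a ^+ 2 <= a * mu by rewrite expr2 ler_pM2l.
by move: h h1 h2; lra.
Qed.

(** Otherwise all vertices of [Y] have degree 0 into [X]. *)
Lemma edge_dense X Y : 4 * a ^+ 2 < #|Y|%:R * #|X|%:R ->
  exists x y, [/\ x \in X, y \in Y & edge x y].
Proof.
move=> big; have /existsP[y /andP[yY /existsP[x /andP[xX exy]]]] :
    [exists y, (y \in Y) && [exists x, (x \in X) && edge x y]].
  apply: contraTT big; rewrite negb_exists => /forallP no; rewrite -leNgt.
  apply: few_low => v vY; have -> : deg v X = 0%N.
    apply/eqP; rewrite cards_eq0 -subset0; apply/subsetP => u; rewrite inE.
    case/andP => uX; have := no v; rewrite vY negb_exists => /forallP/(_ u).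
    by rewrite uX edge_sym /= => /negPf->.
  by rewrite mulr0 mulr_ge0 // ltW.
by exists x, y.
Qed.

Lemma notin_low (Z : {set G}) (s : seq {set G}) :
    (\sum_(X <- s) #|low X| < #|Z|)%N ->
  exists2 z, z \in Z & {in s, forall X, z \notin low X}.
Proof.
move=> lt; have : ~~ (Z \subset \bigcup_(X <- s) low X).
  apply: contraL lt => /subset_leq_card le; rewrite -leqNgt (leq_trans le) //.
  elim/big_rec2: _ => [|X A B _ h]; first by rewrite cards0.
  by apply: leq_trans (leq_card_setU _ _).1 _; rewrite leq_add2l.
case/subsetPn => z zZ zs; exists z => // X Xs.
by apply: contra zs => zX; rewrite (big_rem X) //= inE zX.
Qed.

Lemma edge_between_large X Y : (m <= #|X|)%N -> (m <= #|Y|)%N ->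
  exists x y, [/\ x \in X, y \in Y & edge x y].
Proof.
rewrite -!(ler_nat R) => hX hY; apply: edge_dense.
have h : m%:R * m%:R <= #|Y|%:R * #|X|%:R :> R by rewrite ler_pM.
by apply: lt_le_trans h; have := a_gt0; move: m_gt; nra.
Qed.

(** A vertex [z] of [Z] with typical degrees has more than [3 * a] neighbours in
    both [X] and [Y], enough for an edge between them. *)
Lemma triangle_across_large X Y (Z : {set G}) :
    (T <= #|X|)%N -> (T <= #|Y|)%N -> (m <= #|Z|)%N ->
  exists x y z, [/\ x \in X, y \in Y & z \in Z] /\
    [/\ edge x y, edge x z & edge y z].
Proof.
rewrite -!(ler_nat R) => /(lt_le_trans T_gt) hX /(lt_le_trans T_gt) hY hZ.
have [z zZ zlow] : exists2 z, z \in Z & {in [:: X; Y], forall X, z \notin low X}.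
  apply: notin_low; rewrite !big_cons big_nil addn0 -(ltr_nat R) natrD.
  have := card_low (ltW hX); have := card_low (ltW hY).
  by move: (lt_le_trans m_gt hZ) a_gt0; lra.
have dX := lowPn (zlow X (mem_head _ _)).
have dY : p * #|Y|%:R < 2 * (deg z Y)%:R by apply/lowPn/zlow; rewrite !inE eqxx orbT.
have hX' : 3 * a < (deg z X)%:R.
  by have : p * (6 * mu) < p * #|X|%:R by [rewrite ltr_pM2l]; lra.
have hY' : 3 * a < (deg z Y)%:R.
  by have : p * (6 * mu) < p * #|Y|%:R by [rewrite ltr_pM2l]; lra.
have [|x [y []]] := @edge_dense [set x in X | edge z x] [set y in Y | edge z y].
  by rewrite -/(deg z X) -/(deg z Y); have := a_gt0; nra.
rewrite !inE => /andP[xX ezx] /andP[yY ezy] exy.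
by exists x, y, z; rewrite !(edge_sym _ z).
Qed.

(** A vertex [x] of [U] with typical degrees has more than [3 * a] neighbours in
    each of [S], [W] and [U].  Fewer than [3 * a] of those in [U] miss one of
    the neighbourhoods in [S] and [W]; any other one, [y], completes the
    central edge [x y] of a diamond. *)
Lemma diamond_across_large (S W U : {set G}) :
    (T <= #|S|)%N -> (T <= #|W|)%N -> (T <= #|U|)%N ->
  exists s t a b, [/\ s \in S, t \in W, a \in U & b \in U] /\
    [/\ edge s a, edge s b, edge a b, edge t a & edge t b].
Proof.
rewrite -!(ler_nat R) => /(lt_le_trans T_gt) hS /(lt_le_trans T_gt) hW.
move=> /(lt_le_trans T_gt) hU.
have [x xU xlow] : exists2 z, z \in U & {in [:: S; W; U], forall X, z \notin low X}.
  apply: notin_low; rewrite !big_cons big_nil addn0 -(ltr_nat R) !natrD.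
  have := card_low (ltW hS); have := card_low (ltW hW); have := card_low (ltW hU).
  by move: a_le_mu mu_gt0; lra.
have dg X : X \in [:: S; W; U] -> 6 * mu < #|X|%:R -> 3 * a < (deg x X)%:R.
  move=> /xlow/lowPn h1 h2.
  by have : p * (6 * mu) < p * #|X|%:R by [rewrite ltr_pM2l]; lra.
have dS := dg S (mem_head _ _) hS.
have dW : 3 * a < (deg x W)%:R by apply: dg; rewrite // !inE eqxx orbT.
have dU : 3 * a < (deg x U)%:R by apply: dg; rewrite // !inE eqxx !orbT.
pose N X : {set G} := [set y in X | edge x y].
pose B X : {set G} := [set y in N U | deg y (N X) == 0%N].
have cB X : 3 * a < (deg x X)%:R -> 3 * #|B X|%:R <= 4 * a.
  move=> h; have : #|B X|%:R * #|N X|%:R <= 4 * a ^+ 2.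
    apply: few_low => v; rewrite inE => /andP[_ /eqP->].
    by rewrite mulr0 mulr_ge0 // ltW.
  rewrite -/(deg x X) => le; rewrite -(ler_pM2r a_gt0).
  have := ler_wpM2l (ler0n R #|B X|) (ltW h).
  by move: le; rewrite expr2; lra.
have [y yU] : exists2 y, y \in N U & y \notin B S :|: B W.
  apply/subsetPn; apply: contraL (cB S dS) => /subset_leq_card.
  move=> /leq_trans/(_ (leq_card_setU _ _).1); rewrite -(ler_nat R) natrD -ltNge.
  by rewrite -/(deg x U); have := cB W dW; move: dU a_gt0; lra.
move: (yU); rewrite !inE => /andP[yU' exy]; rewrite yU' exy /= negb_or.
rewrite !cards_eq0 => /andP[/set0Pn[s] sy /set0Pn[t] ty].
move: sy ty; rewrite !inE => /andP[/andP[sS exs] eys] /andP[/andP[tW ext] eyt].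
by exists s, t, x, y; split=> //; split=> //; rewrite edge_sym.
Qed.

Lemma low_degree_few X : (20 * T <= #|X|)%N ->
  (#|[set v | (deg v X < 10 * m)%N]| <= m)%N.
Proof.
rewrite -(ler_nat R) natrM => hX; have a1 := scale_ge1.
have hX' : 120 * mu <= #|X|%:R by move: hX T_gt; lra.
have hX6 : 6 * mu <= #|X|%:R by move: hX' mu_gt0; lra.
apply: leq_trans (_ : #|low X| <= m)%N; last first.
  by rewrite -(ler_nat R); have := card_low hX6; move: m_gt a_gt0; lra.
apply/subset_leq_card/subsetP => v; rewrite !inE -(ltr_nat R) natrM => dv.
by have := ler_wpM2l (ltW p_gt0) hX'; move: dv m_le; lra.
Qed.

End Pseudorandomness.

(** * The theorem *)

Section Main.
Variable R : realType.

Lemma ln_ge_half (n : nat) : (1 < n)%N -> 1 / 2 <= ln (n%:R : R).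
Proof.
move=> n1; have l2 : 1 / 2 <= ln (2 : R).
  have h : -1 < - (1 / 2) :> R by lra.
  have := le_ln1Dx h.
  have -> : 1 + - (1 / 2) = 2^-1 :> R by field.
  by rewrite lnV ?posrE; lra.
by apply: le_trans l2 _; rewrite ler_ln ?posrE ?ltr0n ?ler_nat // ltnW.
Qed.

(** From [ln 2 >= 1 / 2]; the number of levels is thus [O(ln n)]. *)
Lemma log2_le_ln (n : nat) : (1 < n)%N ->
  exists2 k : nat, (n <= 2 ^ k)%N & k%:R <= 4 * ln (n%:R : R).
Proof.
move=> n1; exists (trunc_log 2 n).+1; first by rewrite ltnW // trunc_log_ltn.
have n0 : (0 < n)%N by apply: ltnW.
have l := ln_ge_half n1; have l2 := ln_ge_half (isT : (1 < 2)%N).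
have : (trunc_log 2 n)%:R * ln (2 : R) <= ln (n%:R : R).
  rewrite mulr_natl -lnXn // -natrX ler_ln ?posrE ?ltr0n ?expn_gt0 //.
  by rewrite ler_nat trunc_logP.
have := ler_wpM2l (ler0n R (trunc_log 2 n)) l2.
rewrite -[(trunc_log 2 n).+1%:R]natr1.
by move: l; lra.
Qed.

Lemma nat_above (x : R) : 0 <= x -> exists t : nat, x < t%:R <= x + 1.
Proof.
move=> x0; exists (Num.truncn x).+1; have /andP[h ->] := truncn_itv x0.
by rewrite -natr1 lerD2r.
Qed.

End Main.

Theorem theorem1p1 (R : realType) :
  exists eps : R, 0 < eps /\
    forall (n d : nat) (G : sgraph),
      (0 < n)%N -> (3 %| n)%N -> #|G| = n -> regular G d ->
      second_eigenvalue R G < eps * d%:R ^+ 2 / (n%:R * ln n%:R) ->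
      exists P : {set {set G}}, triangle_factor P.
Proof.
(* With at most [4 * ln n] levels and [T <= 7 * mu], the levels occupy at most
   [28000 * eps * n] vertices. *)
have [eps eps0 epsE] : exists2 eps : R, 0 < eps & eps * 1000 * 100 = 1.
  exists (1000 * 100)^-1; first by rewrite invr_gt0 mulr_gt0.
  by rewrite -mulrA mulVf // mulf_neq0 // pnatr_eq0.
exists eps; split=> // n d G n0 d3 cG regG gap.
have n1 : (1 < n)%N by case: n n0 d3 {cG gap} => [|[]].
have nR : 0 < n%:R :> R by rewrite ltr0n.
have lnn := ln_ge_half R n1; set L : R := ln n%:R in lnn gap.
have L0 : 0 < L by lra.
set lam := second_eigenvalue R G in gap.
have lam0 : 0 <= lam by exact: second_eigenvalue_ge0.
have d0 : 0 < d%:R :> R.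
  rewrite ltr0n lt0n; apply: contraTneq gap => ->.
  by rewrite expr0n mulr0 mul0r -leNgt.
have dn : d%:R <= n%:R :> R.
  have /card_gt0P[v _] : (0 < #|G|)%N by rewrite cG.
  by rewrite ler_nat -(regG v) -cG max_card.
pose p : R := d%:R / n%:R; pose mu : R := eps * n%:R / L.
have p0 : 0 < p by rewrite divr_gt0.
have p1 : p <= 1 by rewrite ler_pdivrMr // mul1r.
have mu0 : 0 < mu by rewrite divr_gt0 // mulr_gt0.
have muL : mu * L = eps * n%:R by rewrite /mu; field; rewrite gt_eqF.
have lam_lt : lam < p * (p * mu).
  apply: lt_le_trans gap _; rewrite le_eqVlt; apply/orP; left; apply/eqP.
  by rewrite /p /mu; field; rewrite !gt_eqF.
have lam_d : lam < d%:R.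
  apply: lt_le_trans lam_lt _; have -> : d%:R = p * n%:R.
    by rewrite /p mulfVK // gt_eqF.
  rewrite ler_pM2l //; apply: le_trans (_ : mu <= _); first by rewrite ler_piMl // ltW.
  rewrite /mu ler_pdivrMr // mulrC ler_pM2l //.
  by apply: le_trans lnn; lra.
have G0 : (0 < #|G|)%N by rewrite cG.
have var X : \sum_(v : G) ((deg v X)%:R - p * #|X|%:R) ^+ 2 <=
    (p * (p * mu)) ^+ 2 * #|X|%:R.
  have := degree_variance X regG lam_d; rewrite cG -/p -/lam => /le_trans; apply.
  rewrite ler_wpM2r // lerXn2r ?nnegrE //; last exact: ltW.
  exact: le_trans lam0 (ltW lam_lt).
have a1 := scale_ge1 p0 G0 var mu0.
have a_mu : p * mu <= mu by rewrite ler_piMl // ltW.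
have [T /andP[T_gt T_le]] := nat_above (ltW (mulr_gt0 (ltr0n R 6) mu0)).
have a0 : 0 < p * mu by apply: lt_le_trans a1.
have [m /andP[m_gt m_le]] := nat_above (ltW (mulr_gt0 (ltr0n R 4) a0)).
have [k nk kL] := log2_le_ln R n1; rewrite -/L in kL.
have m0 : (0 < m)%N by rewrite -(ltr_nat R); lra.
have mT : (m <= T)%N by rewrite -ltnS -(ltr_nat R) -natr1; lra.
have nT : ((973 * k + 30) * T <= n)%N.
  rewrite -(ler_nat R) natrM natrD natrM.
  have T7 : T%:R <= 7 * mu by lra.
  have c4 : 973 * k%:R + 30 <= 4000 * L :> R by lra.
  have /le_trans -> // : (973%:R * k%:R + 30%:R) * T%:R <= 4000 * L * (7 * mu) :> R.
    by rewrite ler_pM // addr_ge0 // mulr_ge0.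
  have -> : 4000 * L * (7 * mu) = 4000 * 7 * (mu * L) by ring.
  rewrite muL mulrA -[leRHS]mul1r ler_wpM2r //; lra.
apply: tiled_factor.
apply: (pseudorandom_tiled m0 mT _ _ _ _ (k := k)).
- exact: edge_between_large p0 var mu0 m_gt.
- exact: triangle_across_large p0 p1 var mu0 T_gt m_gt.
- exact: diamond_across_large p0 p1 var mu0 T_gt.
- by apply: (low_degree_few (p := p) (mu := mu)).
- by rewrite cG.
- apply: leq_trans nk; apply: leq_trans nT; rewrite leq_pmull //.
  by rewrite addn_gt0 orbT.
- by rewrite cG.
- move=> v; have -> : deg v [set: G] = d.
    by rewrite -(regG v); congr #|pred_of_set _|; apply/setP => u; rewrite !inE.
  rewrite -(ler_nat R) natrM.
  have n120 : 30 * T%:R <= n%:R :> R.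
    rewrite -natrM ler_nat; apply: leq_trans nT; rewrite leq_mul2r.
    by rewrite leq_addl orbT.
  have -> : d%:R = p * n%:R by rewrite /p mulfVK // gt_eqF.
  have : p * (180 * mu) <= p * n%:R by rewrite ler_pM2l //; lra.
  lra.
Qed.
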